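(* Let $K$ be a field, $G$ a graph on $[n]$, $S=K[x_1,\dots,x_n,y_1,\dots,y_n]$, $J_G\subset S$ the binomial edge ideal of $G$, and $d=\dim S/J_G$. (a) If $P$ is a semi-path in $G$ of length $r$, then $r\leq 2n-d$. (b) The following conditions are equivalent: (i) $J_G$ is of König type. (ii) There exists a semi-path in $G$ of length $2n-d$.
   Context: Graphs are finite and simple. The binomial edge ideal of $G$ is $J_G=(f_{ij} : i<j,\ \{i,j\}\in E(G))$ with $f_{ij}=x_iy_j-x_jy_i$. A path graph is a graph with distinct vertices $i_1,\dots,i_m$ ($m\ge 1$) and edges $\{i_k,i_{k+1}\}$, $1\le k\le m-1$. A semi-path in $G$ is a subgraph $P$ of $G$ each of whose connected components is a path graph; its length is its number of edges. A graded ideal $I$ of height $h$ in a polynomial ring over a field is of König type if there exist a sequence $f_1,\dots,f_h$ of homogeneous polynomials forming part of a minimal system of generators of $I$ and a monomial order $<$ such that $\operatorname{in}_<(f_1),\dots,\operatorname{in}_<(f_h)$ is a regular sequence. *)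

(* Defs.v *)
From HB Require Import structures.
From mathcomp Require Import all_boot all_order all_algebra.
From mathcomp Require Import boolp.
From mathcomp Require Import mpoly.

Set Implicit Arguments.
Unset Strict Implicit.
Unset Printing Implicit Defensive.

Import GRing.Theory.
Local Open Scope ring_scope.

Record graph (T : finType) := Graph {
  vertices : {set T};
  adj : rel T;
  adj_sym : ssrbool.symmetric adj;
  adj_irr : irreflexive adj;
  adj_vertex : forall x y, adj x y -> x \in vertices
}.

Section Graphs.
Variable T : finType.
Implicit Types (G H : graph T) (x y : T).

Definition edges G : {set {set T}} :=
  [set [set p.1; p.2] | p : T * T & adj G p.1 p.2].

Definition subgraph H G : Prop :=
  vertices H \subset vertices G /\ subrel (adj H) (adj G).

Definition component_vertices G x : {set T} :=
  [set y in vertices G | connect (adj G) x y].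

Definition component_adj G x : rel T :=
  [rel y z | [&& adj G y z, y \in component_vertices G x
                          & z \in component_vertices G x]].

Lemma component_adj_sym G x : ssrbool.symmetric (component_adj G x).
Proof. by move=> y z; rewrite /component_adj /= adj_sym [X in _ && X]andbC. Qed.

Lemma component_adj_irr G x : irreflexive (component_adj G x).
Proof. by move=> y; rewrite /component_adj /= adj_irr. Qed.

Lemma component_adj_vertex G x y z :
  component_adj G x y z -> y \in component_vertices G x.
Proof. by case/and3P. Qed.

Definition component G x : graph T :=
  Graph (component_adj_sym G x) (component_adj_irr G x)
    (@component_adj_vertex G x).

(* The list s enumerates the vertices i_1, ..., i_m in path order; since s is
   duplicate-free, "x is i_k" reads "index x s = k - 1". *)
Definition path_graph G : Prop :=
  exists s : seq T,
    [/\ s != [::], uniq s, vertices G = [set x in s]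
      & {in vertices G &, forall x y,
          adj G x y = (index y s == (index x s).+1)
                      || (index x s == (index y s).+1)}].

Definition semi_path G H : Prop :=
  subgraph H G /\ {in vertices H, forall x, path_graph (component H x)}.

Definition semi_path_length H : nat := #|edges H|.

End Graphs.

Section Ideals.
Variable R : comNzRingType.

Definition ideal_gen (s : seq R) : {pred R} :=
  fun u => `[< exists a : 'I_(size s) -> R, u = \sum_(i < size s) a i * s`_i >].

Definition prime_chain (k : nat) (p : nat -> prime_idealr R) : Prop :=
  forall i, (i < k)%N ->
    {subset p i <= p i.+1} /\ ~ {subset p i.+1 <= p i}.

Definition prime_height (P : prime_idealr R) (h : nat) : Prop :=
  (exists p, prime_chain h p /\ p h =i P)
  /\ (forall k p, prime_chain k p -> p k =i P -> (k <= h)%N).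

Definition ideal_height (I : {pred R}) (h : nat) : Prop :=
  (exists P : prime_idealr R, {subset I <= P} /\ prime_height P h)
  /\ (forall (P : prime_idealr R) k,
        {subset I <= P} -> prime_height P k -> (h <= k)%N).

Definition regular_sequence (s : seq R) : Prop :=
  (forall i, (i < size s)%N -> forall u,
     u * s`_i \in ideal_gen (take i s) -> u \in ideal_gen (take i s))
  /\ 1 \notin ideal_gen s.

End Ideals.

Definition krull_dim (R : comNzRingType) (d : nat) : Prop :=
  (exists p : nat -> prime_idealr R, prime_chain d p)
  /\ (forall k (p : nat -> prime_idealr R), prime_chain k p -> (k <= d)%N).

Section Konig.
Variables (K : fieldType) (N : nat).
Implicit Types (f : {mpoly K[N]}) (s : seq {mpoly K[N]}).

Definition monomial_order (le : rel 'X_{1..N}) : Prop :=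
  [/\ reflexive le, antisymmetric le, transitive le, total le
    & (forall m, le 0%MM m)
      /\ (forall m1 m2 m, le m1 m2 -> le (m1 + m)%MM (m2 + m)%MM)].

(* The initial monomial of f, with in(0) = 0 by convention. *)
Definition initial_monomial (le : rel 'X_{1..N}) f : {mpoly K[N]} :=
  if f == 0 then 0 else 'X_[last 0%MM (sort le (msupp f))].

(* For homogeneous systems of generators, being irredundant and having the
   least possible number of elements are the same. *)
Definition minimal_generators (I : {pred {mpoly K[N]}}) s : Prop :=
  [/\ {in s, forall f, f \is homog mdeg},
      ideal_gen s =i I
    & forall t, subseq t s -> ideal_gen t =i I -> t = s].

Definition Konig_type (I : {pred {mpoly K[N]}}) : Prop :=
  exists h, ideal_height I h /\
  exists f : h.-tuple {mpoly K[N]},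
    (exists g, minimal_generators I (f ++ g)) /\
    exists le, monomial_order le /\
      regular_sequence [seq initial_monomial le fi | fi <- f].

End Konig.

Section BinomialEdgeIdeal.
Variables (K : fieldType) (n : nat) (G : graph 'I_n).

(* In {mpoly K[n + n]} the variables x_i are the first n indeterminates and the
   variables y_i the last n. *)
Definition varx (i : 'I_n) : {mpoly K[n + n]} := 'X_(lshift n i).
Definition vary (i : 'I_n) : {mpoly K[n + n]} := 'X_(rshift n i).

Definition edge_binomial (i j : 'I_n) : {mpoly K[n + n]} :=
  varx i * vary j - varx j * vary i.

Definition edge_binomials : seq {mpoly K[n + n]} :=
  [seq edge_binomial p.1 p.2 | p : 'I_n * 'I_n <- enum {: 'I_n * 'I_n}
                             & (p.1 < p.2)%N && adj G p.1 p.2].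

Definition binomial_edge_ideal : {pred {mpoly K[n + n]}} :=
  ideal_gen edge_binomials.

Lemma binomial_edge_idealr_closed : idealr_closed binomial_edge_ideal.
Proof.
split.
- apply/asboolP; exists (fun=> 0).
  by rewrite big1 // => i _; rewrite mul0r.
- apply/negP => /asboolP[a] /(congr1 (mcoeff 0%MM)).
  rewrite mcoeff1 eqxx raddf_sum big1 /= => [/eqP|i _]; first by rewrite oner_eq0.
  have /mapP[p _ ->] := mem_nth 0 (ltn_ord i).
  by rewrite /edge_binomial /varx rmorphM rmorphB !rmorphM /= !mcoeffX
    !mnm1_eq0 !mul0r subrr mulr0.
- move=> c u v /asboolP[a ->] /asboolP[b ->]; apply/asboolP.
  exists (fun i => c * a i + b i); rewrite mulr_sumr -big_split /=.
  by apply: eq_bigr => i _; rewrite mulrDl mulrA.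
Qed.

HB.instance Definition _ :=
  isIdealr.Build {mpoly K[n + n]} binomial_edge_ideal
    binomial_edge_idealr_closed.

End BinomialEdgeIdeal.

Arguments binomial_edge_ideal K {n} G.

(* Main.v *)
Require Import Defs.
From HB Require Import structures.
From mathcomp Require Import all_boot all_order all_algebra.
From mathcomp Require Import boolp.
From mathcomp Require classical_sets.
From mathcomp Require Import mpoly.
From mathcomp Require Import ring zify.

Set Implicit Arguments.
Unset Strict Implicit.
Unset Printing Implicit Defensive.

Import GRing.Theory.
Local Open Scope ring_scope.

(** The argument has an algebraic half, which computes the height of a
    binomial edge ideal from the dimension of its quotient, and a
    combinatorial half about semi-paths.

    Algebra.  Let S be a polynomial ring in N variables.  For a prime P write
    [trdeg P] for the largest number of variables that are algebraically
    independent modulo P.  A strict inclusion of primes lowers [trdeg]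
    ([trdeg_strict]), a prime with [trdeg P > 0] lies strictly below a prime
    whose [trdeg] is exactly one less ([prime_above]), and below P there is a
    chain of length [N - trdeg P] ([prime_chain_below]).  Hence P has height
    [N - trdeg P], the dimension d of S/I is the largest [trdeg] of a prime
    containing I, and I has height N - d ([height_krull_dim]).  The first two
    facts rest on one observation ([clear_denominators]): if A is a maximal
    independent set of variables modulo P, a single nonzero element c of K[A]
    has the property that every element of S/P becomes integral over K[A] after
    multiplication by a power of c.

    Part (a).  A semi-path is an undirected copy of a relation D in which every
    vertex has at most one successor and one predecessor and which has no cycle
    ([path_orientation]).  The vectors (x_i, y_i) and (x_j, y_j) are
    proportional modulo a prime containing J_G whenever i and j are adjacent.
    So if A is independent modulo such a prime, two vertices of one path that
    both have their two variables in A must be separated by a vertex with none,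
    and this gives |A| + r <= 2n for a semi-path of length r
    ([card_indep_semi_path]).  Taking for P the bottom of a chain of length d
    yields d + r <= 2n.

    Part (b).  Monomials of degree 2 form a regular sequence exactly when they
    are pairwise coprime ([regular_monomials],
    [regular_quadratic_monomials]).  Given a semi-path of length 2n - d, weigh
    a monomial by the positions of its y-variables along the paths: the initial
    monomial of the binomial of an edge i -> j is then x_i y_j, and these are
    pairwise coprime because D is injective and functional.  Conversely, the
    members of a minimal generating system of J_G are quadrics
    ([quadratic_generators]), and with x_i y_j each of them contains x_j y_i.
    Coprime initial monomials x_i y_j therefore define a relation i -> j with
    at most one successor and one predecessor everywhere.  It has no cycle,
    because any monomial order totally orders the vertices by comparing
    x_i y_j with x_j y_i ([vertex_order]). *)

(** * Primes as kernels of morphisms to domains *)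

Definition mk_prime (R : comNzRingType) (P : {pred R}) (hI : idealr_closed P)
    (hP : prime_idealr_closed P) : prime_idealr R :=
  HB.pack_for (prime_idealr R) (P : R -> bool)
    (isIdealr.Build R P hI) (isPrimeIdealrClosed.Build R P hP).

Section KernelPrime.
Variables (R : comNzRingType) (E : idomainType) (f : {rmorphism R -> E}).

Definition ker_pred : {pred R} := [pred u | f u == 0].

Lemma ker_pred_idealr_closed : idealr_closed ker_pred.
Proof.
split=> [||a u v]; rewrite !inE ?rmorph0 ?rmorph1 ?eqxx ?oner_eq0 //.
by rewrite rmorphD rmorphM /= => /eqP-> /eqP->; rewrite mulr0 addr0.
Qed.

Lemma ker_pred_prime : prime_idealr_closed ker_pred.
Proof. by move=> u v; rewrite !inE rmorphM mulf_eq0. Qed.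

Definition ker_prime := mk_prime ker_pred_idealr_closed ker_pred_prime.

Lemma ker_primeE u : (u \in ker_prime) = (f u == 0).
Proof. by []. Qed.

End KernelPrime.

Section ResidueDomain.
Variables (R : comNzRingType) (P : prime_idealr R).

Definition residue_domain := {ideal_quot P}.
HB.instance Definition _ := GRing.ComNzRing.on residue_domain.
Local Notation D := residue_domain.

Definition residue_unit : {pred D} := fun x => `[< exists y, y * x = 1 >].

(** Invertibility in the residue ring need not be decidable, so the inverse is
    chosen classically. *)
Definition residue_inv (x : D) : D :=
  if pselect (exists y, y * x = 1) is left h then projT1 (cid h) else x.

Lemma residue_mulVr : {in residue_unit, left_inverse 1 residue_inv *%R}.
Proof.
move=> x /asboolP hx; rewrite /residue_inv; case: pselect => // h.
exact: (projT2 (cid h)).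
Qed.

Lemma residue_unitP x y : y * x = 1 -> x \in residue_unit.
Proof. by move=> h; apply/asboolP; exists y. Qed.

Lemma residue_inv_out : {in [predC residue_unit], residue_inv =1 id}.
Proof.
by move=> x; rewrite inE /= => /asboolP hx; rewrite /residue_inv; case: pselect.
Qed.

HB.instance Definition _ :=
  GRing.ComNzRing_hasMulInverse.Build D residue_mulVr residue_unitP
    residue_inv_out.
HB.instance Definition _ :=
  GRing.ComUnitRing_isIntegral.Build D (@Quotient.rquot_IdomainAxiom R P).

(** Presenting a prime as a kernel lets primality of the ideals constructed
    below follow from the absence of zero divisors in a target ring. *)
Lemma prime_residue_domain :
  exists (E : idomainType) (f : {rmorphism R -> E}),
    forall u, (u \in P) = (f u == 0).
Proof.
exists D; pose f : {rmorphism R -> {ideal_quot P}} := \pi_({ideal_quot P})%qT.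
exists f => u.
by rewrite -[u in LHS]subr0 Quotient.idealrBE rmorph0.
Qed.

End ResidueDomain.

(** * Primes avoiding a multiplicative set *)

Section PrimeAvoidance.
Variables (R : comNzRingType) (I : {pred R}) (M : R -> Prop).

(** An ideal that is maximal among those containing I and missing M is prime:
    two elements outside it each produce, together with it, an element of M,
    and the product of these two lies in M. *)
Lemma prime_avoiding :
  0 \in I -> (forall a, {in I &, forall u v, a * u + v \in I}) ->
  M 1 -> (forall u v, M u -> M v -> M (u * v)) ->
  (forall u, u \in I -> ~ M u) ->
  exists Q : prime_idealr R, {subset I <= Q} /\ forall u, u \in Q -> ~ M u.
Proof.
move=> I0 Iclosed M1 MM IM.
(* Zorn's lemma is applied to the sets X whose union with I has the required
   properties, so that the empty chain is bounded too. *)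
pose J (X : classical_sets.set R) u := u \in I \/ X u.
pose good (X : classical_sets.set R) :=
  (forall a u v, J X u -> J X v -> J X (a * u + v)) /\ (forall u, J X u -> ~ M u).
have [|X [[Xcl XM] Xmax]] := @classical_sets.Zorn_bigcup R good.
  move=> F Fgood Ftot; split.
    move=> a u v [uI|[X FX Xu]] [vI|[Y FY Yv]].
    - by left; apply: Iclosed.
    - have [h _] := Fgood _ FY.
      by case: (h a u v (or_introl uI) (or_intror Yv)); [left|right; exists Y].
    - have [h _] := Fgood _ FX.
      by case: (h a u v (or_intror Xu) (or_introl vI)); [left|right; exists X].
    - have [XY|YX] := Ftot _ _ FX FY.
        have [h _] := Fgood _ FY.
        case: (h a u v (or_intror (XY _ Xu)) (or_intror Yv)); first by left.
        by right; exists Y.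
      have [h _] := Fgood _ FX.
      case: (h a u v (or_intror Xu) (or_intror (YX _ Yv))); first by left.
      by right; exists X.
  move=> u [uI|[X FX Xu]]; first exact: IM.
  by have [_ h] := Fgood _ FX; apply: h; right.
pose Q : {pred R} := fun u => `[< J X u >].
have QP u : reflect (J X u) (u \in Q) by exact: asboolP.
have Q0 : 0 \in Q by apply/QP; left.
have QI : idealr_closed Q.
  split=> //; first by apply/QP => /XM.
  by move=> a u v /QP hu /QP hv; apply/QP/Xcl.
(* By maximality, adjoining an element outside Q forces M to be met. *)
have Qmax u : u \notin Q -> exists a q, q \in Q /\ M (a * u + q).
  move=> uQ; apply: contrapT => noM.
  pose Y : classical_sets.set R := fun w => exists a q, q \in Q /\ w = a * u + q.
  have JY w : J Y w <-> Y w.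
    split; last by right.
    by case=> // wI; exists 0, w; rewrite mul0r add0r; split=> //; apply/QP; left.
  apply: (Xmax Y).
    split.
      by move=> w Xw; exists 0, w; rewrite mul0r add0r; split=> //; apply/QP; right.
    by move=> /(_ u) YX; case/QP: uQ; right; apply: YX; exists 1, 0;
      rewrite mul1r addr0.
  split.
    move=> a v w /JY[b [q [qQ ->]]] /JY[c [r [rQ ->]]]; apply/JY.
    exists (a * b + c), (a * q + r); split; first by case: QI => _ _; apply.
    by rewrite mulrDl mulrDr !mulrA addrACA.
  by move=> w /JY[a [q [qQ ->]]] Mw; apply: noM; exists a, q.
have Qprime : prime_idealr_closed Q.
  move=> u v uvQ; apply: contrapT => /negP; rewrite negb_or => /andP[uQ vQ].
  have [a [q [qQ Mu]]] := Qmax _ uQ; have [b [r [rQ Mv]]] := Qmax _ vQ.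
  apply: (XM _ _ (MM _ _ Mu Mv)); apply/QP.
  have [_ _ Qcl] := QI.
  rewrite mulrDl mulrDr -addrA mulrACA; apply: (Qcl) => //.
  rewrite [q * _]mulrC; apply: (Qcl) => //.
  by rewrite -[_ * q]addr0; apply: Qcl.
exists (mk_prime QI Qprime); split=> [u uI|u /QP]; last exact: XM.
by apply/QP; left.
Qed.

End PrimeAvoidance.

(** * Clearing denominators of algebraic elements *)

Section IntegralClearing.
Variables (R S : comNzRingType) (f : {rmorphism R -> S}).

(** With c the leading coefficient and m the degree, multiply the equation
    q(x) = 0 by c^(m-1): it becomes monic in c x. *)
Lemma integral_lead_coef (q : {poly R}) (x : S) :
  root (map_poly f q) x -> integralOver f (f (lead_coef q) * x).
Proof.
move=> /rootP qx; have [q1|q_gt1] := leqP (size q) 1.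
  have := qx; rewrite (size1_polyC q1) map_polyC hornerC lead_coefC => ->.
  by rewrite mul0r; apply: integral0.
pose c := lead_coef q; pose m := (size q).-1.
have mE : size q = m.+1 by rewrite /m prednK // ltnW.
have m_gt0 : (0 < m)%N by rewrite -ltnS -mE.
pose p := 'X^m + \poly_(i < m) (q`_i * c ^+ (m.-1 - i)).
have p_monic : p \is monic.
  by apply/monicP; rewrite lead_coefDl ?lead_coefXn // size_polyXn ltnS size_poly.
exists p => //; apply/rootP.
have pE : (map_poly f p).[f c * x] = f c ^+ m.-1 * (map_poly f q).[x].
  rewrite rmorphD /= map_polyXn hornerD hornerXn.
  rewrite [in RHS](@horner_coef_wide _ m.+1) -?mE ?size_poly //.
  rewrite mE big_ord_recr /= mulrDr addrC; congr (_ + _); last first.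
    rewrite coef_map -[q`_m]/(lead_coef q) -/c exprMn mulrA -exprSr.
    by rewrite prednK.
  rewrite (@horner_coef_wide _ m); last first.
    exact: leq_trans (size_poly _ _) (size_poly _ _).
  rewrite mulr_sumr; apply: eq_bigr => i _.
  rewrite !coef_map coef_poly ltn_ord /= rmorphM rmorphXn exprMn.
  have -> : f c ^+ m.-1 = f c ^+ (m.-1 - i) * f c ^+ i.
    by rewrite -exprD subnK // -ltnS prednK.
  by rewrite [f q`_i * _]mulrC -!mulrA; congr (_ * _); rewrite mulrCA.
by rewrite pE qx mulr0.
Qed.

End IntegralClearing.

(** * Subrings generated by some of the variables *)

Section Variables.
Variables (K : fieldType) (N : nat).
Local Notation S := {mpoly K[N]}.
Implicit Types (A B : {set 'I_N}) (z : 'I_N) (f u : S).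

(** Source of all the identities between substitutions used later. *)
Lemma mpoly_hom_ext (R : comNzRingType) (g h : {rmorphism S -> R}) :
  (forall c, g c%:MP = h c%:MP) -> (forall i, g 'X_i = h 'X_i) -> g =1 h.
Proof.
move=> ghC ghX f; rewrite (mpolyE f) !rmorph_sum; apply: eq_bigr => m _ /=.
rewrite -mul_mpolyC !rmorphM ghC; congr (_ * _).
by rewrite mpolyXE_id !rmorph_prod; apply: eq_bigr => i _; rewrite !rmorphXn ghX.
Qed.

(** The projection onto K[A]; membership in K[A] is expressed by being
    fixed by it. *)
Definition retract A : S -> S :=
  mmap (@mpolyC N K) (fun i => if i \in A then 'X_i else 0).
HB.instance Definition _ A := GRing.RMorphism.on (retract A).

Lemma retractC A c : retract A c%:MP = c%:MP.
Proof. by rewrite /retract mmapC. Qed.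

Lemma retractX A i : retract A 'X_i = if i \in A then 'X_i else 0.
Proof. by rewrite /retract mmapX mmap1U. Qed.

Lemma retract_sub A B f : A \subset B -> retract B (retract A f) = retract A f.
Proof.
move=> /subsetP AB.
apply: (@mpoly_hom_ext _ (retract B \o retract A)) => [c|i] /=.
  by rewrite !retractC.
by rewrite retractX; case: ifP => [/AB iB|]; rewrite ?rmorph0 // retractX iB.
Qed.

Lemma retractK A f : retract A (retract A f) = retract A f.
Proof. exact: retract_sub. Qed.

Lemma retractT f : retract setT f = f.
Proof.
apply: (@mpoly_hom_ext _ (retract setT) idfun) => [c|i] /=.
  exact: retractC.
by rewrite retractX inE.
Qed.

(** The coefficients are taken in the whole polynomial ring, which avoids
    renumbering the variables other than X_z. *)
Definition upoly z : S -> {poly S} :=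
  mmap (polyC \o @mpolyC N K) (fun i => if i == z then 'X else ('X_i)%:P).
HB.instance Definition _ z := GRing.RMorphism.on (upoly z).

Lemma upolyC z c : upoly z c%:MP = (c%:MP)%:P.
Proof. by rewrite /upoly mmapC. Qed.

Lemma upolyX z i : upoly z 'X_i = if i == z then 'X else ('X_i)%:P.
Proof. by rewrite /upoly mmapX mmap1U. Qed.

Lemma upoly_eval z f : (upoly z f).['X_z] = f.
Proof.
apply: (@mpoly_hom_ext _ (horner_eval 'X_z \o upoly z) idfun) => [c|i] /=.
  by rewrite /horner_eval upolyC hornerC.
by rewrite /horner_eval upolyX; case: eqP => [->|_]; rewrite ?hornerX ?hornerC.
Qed.

Lemma upoly_inj z : injective (upoly z).
Proof. by move=> f g fg; rewrite -(upoly_eval z f) fg upoly_eval. Qed.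

Lemma upoly_retract z A f : z \notin A ->
  upoly z (retract A f) = (retract A f)%:P.
Proof.
move=> zA.
apply: (@mpoly_hom_ext _ (upoly z \o retract A) (polyC \o retract A)) => [c|i] /=.
  by rewrite !retractC upolyC.
rewrite !retractX; case: ifP => iA; rewrite ?rmorph0 // upolyX.
by case: eqP => // iz; rewrite -iz iA in zA.
Qed.

(** A relation between z and A thus becomes an equation for X_z over K[A]. *)
Lemma upoly_retractU z A f : z \notin A ->
  map_poly (retract A) (upoly z (retract (z |: A) f))
    = upoly z (retract (z |: A) f).
Proof.
move=> zA; apply: (@mpoly_hom_ext _
  (map_poly (retract A) \o (upoly z \o retract (z |: A)))
  (upoly z \o retract (z |: A))) => [c|i] /=.
  by rewrite !retractC upolyC map_polyC /= retractC.
rewrite retractX !inE; case: (eqVneq i z) => [->|iz] /=.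
  by rewrite upolyX eqxx map_polyX.
case: ifP => iA; rewrite ?rmorph0 // upolyX (negPf iz) map_polyC /=.
by rewrite retractX iA.
Qed.

(** Algebraic independence modulo P of the variables in A. *)
Definition indep (P : {pred S}) A :=
  forall f, retract A f \in P -> retract A f = 0.

Lemma indep_subpred (P Q : {pred S}) A :
  {subset P <= Q} -> indep Q A -> indep P A.
Proof. by move=> PQ hQ f /PQ; apply: hQ. Qed.

Lemma dependentP (P : {pred S}) A : ~ indep P A ->
  exists f, retract A f \in P /\ retract A f != 0.
Proof.
move=> /existsNP[f /not_implyP[fP f0]]; exists f; split=> //; exact/eqP.
Qed.

Lemma indep0 (P : prime_idealr S) : indep P set0.
Proof.
move=> f; have -> : retract set0 f = (f@_0%MM)%:MP.
  have -> : f@_0%MM = f.@[fun=> 0].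
    rewrite {1 2}(mpolyE f) !raddf_sum; apply: eq_bigr => m _ /=.
    rewrite mcoeffZ mevalZ mevalX mcoeffX; congr (_ * _).
    have [->|/eqP m0] := eqVneq m 0%MM.
      by rewrite big1 // => i _; rewrite mnm0E.
    have [i mi] : exists i, m i != 0%N.
      apply: contrapT => /forallNP mi; apply: m0; apply/mnmP => i.
      by rewrite mnm0E; apply/eqP; apply: contrapT => /negP /mi.
    by rewrite (bigD1 i) //= expr0n (negPf mi) mul0r.
  apply: (@mpoly_hom_ext _ (retract set0) (@mpolyC N K \o meval (fun=> 0))) => [c|i] /=.
    by rewrite retractC mevalC.
  by rewrite retractX inE mevalXU rmorph0.
have [->|c0] := eqVneq f@_0%MM 0; first by rewrite rmorph0.
move=> cP; have := idealr1 P.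
suff -> : 1 \in P by [].
have -> : 1 = (f@_0%MM)^-1%:MP * (f@_0%MM)%:MP :> S.
  by rewrite -rmorphM mulVf // rmorph1.
exact: idealMr.
Qed.

End Variables.

(** * Independent sets of variables modulo a prime *)

Section Transcendence.
Variables (K : fieldType) (N : nat).
Local Notation S := {mpoly K[N]}.
Implicit Types (A B : {set 'I_N}) (z : 'I_N) (f u : S).

Lemma retract_coef A z f i : z \notin A ->
  retract A (upoly z (retract (z |: A) f))`_i
    = (upoly z (retract (z |: A) f))`_i.
Proof. by move=> zA; rewrite -[in RHS](upoly_retractU f zA) coef_map. Qed.

Section Clearing.
Variables (E : idomainType) (g : {rmorphism S -> E}) (A : {set 'I_N}).
Local Notation P := (ker_prime g).
Hypothesis indA : indep P A.
Hypothesis maxA : forall z, z \notin A -> ~ indep P (z |: A).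
Local Notation gA := (g \o retract A).

(** A variable outside A is a root modulo P of a nonzero polynomial over K[A];
    its leading coefficient survives modulo P since A is independent. *)
Lemma clear_variable z : exists c,
  retract A c \notin P /\ integralOver gA (g (retract A c * 'X_z)).
Proof.
have [zA|zA] := boolP (z \in A).
  exists 1; rewrite rmorph1 mul1r ker_primeE rmorph1 oner_eq0; split=> //.
  have -> : g 'X_z = gA 'X_z by rewrite /= retractX zA.
  exact: integral_id.
have [f [fP f0]] := dependentP (maxA zA).
pose q := upoly z (retract (z |: A) f).
have cE i : retract A q`_i = q`_i by apply: retract_coef.
have q0 : q != 0.
  by apply: contraNneq f0 => q0; rewrite -(upoly_eval z (retract _ f)) -/q q0 horner0.
exists (lead_coef q); rewrite cE; split.
  rewrite /lead_coef -cE; apply/negP => /indA; rewrite cE => /eqP.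
  by rewrite -/(lead_coef q) lead_coef_eq0 (negPf q0).
have := @integral_lead_coef _ _ gA q (g 'X_z).
rewrite /= cE -rmorphM; apply.
have -> : map_poly gA q = map_poly g q.
  by apply/polyP => i; rewrite !coef_map /= cE.
rewrite rootE horner_map -ker_primeE.
by rewrite upoly_eval.
Qed.

(** The product of the denominators of all the variables serves for every
    element, because integral elements form a ring. *)
Lemma clear_denominators : exists C, retract A C \notin P /\
  forall u, exists e, integralOver gA (g (retract A C ^+ e * u)).
Proof.
have /choice[c cP] := clear_variable.
pose C := \prod_z c z.
have retC : retract A C = \prod_z retract A (c z) by rewrite rmorph_prod.
exists C; split.
  rewrite retC ker_primeE rmorph_prod prodf_seq_neq0.
  by apply/allP => z _ /=; have [] := cP z; rewrite ker_primeE.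
pose T u := exists e, integralOver gA (g (retract A C ^+ e * u)).
have TR u : T (retract A u).
  exists 0%N; rewrite expr0 mul1r -(retractK A u).
  exact: (@integral_id _ _ gA (retract A u)).
have IC e : integralOver gA (g (retract A C ^+ e)).
  by rewrite -rmorphXn; apply: (@integral_id _ _ gA (C ^+ e)).
have TM u v : T u -> T v -> T (u * v).
  move=> [d ud] [e ve]; exists (d + e)%N.
  by rewrite exprD mulrACA rmorphM; apply: integral_mul.
have TD u v : T u -> T v -> T (u + v).
  move=> [d ud] [e ve]; exists (d + e)%N.
  rewrite mulrDr rmorphD exprD; apply: integral_add.
    by rewrite mulrAC mulrC rmorphM; apply: integral_mul.
  by rewrite -mulrA rmorphM; apply: integral_mul.
have TX z : T 'X_z.
  exists 1%N; rewrite expr1 retC (bigD1 z) //= mulrAC rmorphM.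
  apply: integral_mul; first by have [] := cP z.
  rewrite -rmorph_prod; exact: (@integral_id _ _ gA).
have TC c0 : T c0%:MP by rewrite -(retractC A c0); apply: TR.
move=> u; rewrite -/(T u) (mpolyE u); elim/big_ind: _ => //.
  by rewrite -mpolyC0; apply: TC.
move=> m _; rewrite -mul_mpolyC; apply: (TM) => //; rewrite mpolyXE_id.
elim/big_ind: _ => [|u1 u2|i _]; [by rewrite -mpolyC1; apply: TC|exact: (TM)|].
elim: (m i) => [|k IH]; first by rewrite expr0 -mpolyC1; apply: TC.
by rewrite exprS; apply: TM.
Qed.

End Clearing.

(** The transcendence degree over K of the residue domain, computed inside the
    set of variables. *)
Definition trdeg (P : {pred S}) : nat :=
  \max_(A : {set 'I_N} | `[< indep P A >]) #|A|.

Lemma trdeg_indep (P : prime_idealr S) :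
  exists A, indep P A /\ #|A| = trdeg P.
Proof.
have /asboolP i0 := @indep0 K N P.
have [|A iA cA] := @eq_bigmax_cond _ [pred A | `[< indep P A >]]
    (fun A : {set 'I_N} => #|A|).
  by apply/card_gt0P; exists set0.
by exists A; split; [apply/asboolP|rewrite -cA].
Qed.

Lemma leq_trdeg (P : {pred S}) A : indep P A -> (#|A| <= trdeg P)%N.
Proof.
by move=> /asboolP iA; apply: (@leq_bigmax_cond _ _ (fun A : {set 'I_N} => #|A|)).
Qed.

Lemma trdeg_leq (P : {pred S}) k :
  (forall A, indep P A -> #|A| <= k)%N -> (trdeg P <= k)%N.
Proof. by move=> h; apply/bigmax_leqP => A /asboolP; apply: h. Qed.

Lemma trdeg_leqN (P : {pred S}) : (trdeg P <= N)%N.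
Proof. by apply: trdeg_leq => A _; rewrite -[N in leqRHS]card_ord max_card. Qed.

Lemma trdeg_max (P : {pred S}) A z :
  #|A| = trdeg P -> z \notin A -> ~ indep P (z |: A).
Proof. by move=> cA zA /leq_trdeg; rewrite cardsU1 zA cA ltnn. Qed.

Lemma eq_indep (P Q : {pred S}) A : P =i Q -> indep P A -> indep Q A.
Proof. by move=> PQ hP f; rewrite -PQ; apply: hP. Qed.

Lemma prime_kernel (P : prime_idealr S) :
  exists (E : idomainType) (g : {rmorphism S -> E}), P =i ker_prime g.
Proof. by have [E [g gP]] := prime_residue_domain P; exists E, g. Qed.

(** A set A independent modulo Q is independent modulo P.  If it were maximal
    for P, then an element w of Q outside P would be integral over K[A] modulo
    P up to a denominator, whereas [transc] shows that it satisfies no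
    equation. *)
Lemma trdeg_strict (P Q : prime_idealr S) :
  {subset P <= Q} -> ~ {subset Q <= P} -> (trdeg Q < trdeg P)%N.
Proof.
move=> PQ QP; have [A [iA cA]] := trdeg_indep Q.
have iPA : indep P A by apply: indep_subpred iA.
rewrite ltn_neqAle -[X in (_ <= X)%N]/(trdeg P) -cA leq_trdeg // andbT.
apply/eqP => cAP; apply: QP => w wQ; apply: contrapT => /negP wP.
have [E [g gP]] := prime_kernel P.
have iA' : indep (ker_prime g) A := eq_indep gP iPA.
have maxA z : z \notin A -> ~ indep (ker_prime g) (z |: A).
  move=> zA /(eq_indep (fun u => esym (gP u))).
  exact: trdeg_max.
have [C [CP clr]] := clear_denominators iA' maxA.
have [e [r r_monic /rootP rw]] := clr w.
pose v := retract A C ^+ e * w.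
have vQ : v \in Q by apply: idealMr.
have vP : v \notin P.
  by rewrite prime_idealrM negb_or wP gP ker_primeE rmorphXn expf_eq0 negb_and CP orbT.
(* An element of Q outside P satisfies no nontrivial equation over K[A]
   modulo P: the constant term would lie in Q, hence vanish, and one could
   divide by the element. *)
have transc (q : {poly S}) :
    (map_poly (retract A) q).[v] \in P -> map_poly (retract A) q = 0.
  elim/poly_ind: q => [|q c IH]; first by rewrite rmorph0.
  rewrite rmorphD rmorphM /= map_polyX map_polyC hornerD hornerMX hornerC /= => h.
  have c0 : retract A c = 0.
    apply: iA; have := PQ _ h.
    set t := _ * v; have tQ : t \in Q by apply: idealMr.
    by move=> htc; rewrite -[retract A c](addKr t) addrC rpredB.
  move: h; rewrite c0 addr0 prime_idealrM (negPf vP) orbF => /IH->.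
  by rewrite mul0r rmorph0 addr0.
have /monicP := monic_map (retract A) r_monic.
rewrite transc ?lead_coef0; first by move/esym/eqP; rewrite oner_eq0.
by rewrite gP ker_primeE -horner_map -map_poly_comp /= rw.
Qed.

Lemma trdeg_chain (k : nat) (p : nat -> prime_idealr S) :
  prime_chain k p -> (trdeg (p k) + k <= trdeg (p 0%N))%N.
Proof.
elim: k => [|k IH] hp; first by rewrite addn0.
have [sub strict] := hp k (ltnSn k).
rewrite addnS -addSn; apply: leq_trans (IH _) => [|i ik].
  by rewrite leq_add2r; apply: trdeg_strict.
exact/hp/ltnW.
Qed.
End Transcendence.

(** * Chains of primes above and below a given prime *)

Section Chains.
Variables (K : fieldType) (N : nat).
Local Notation S := {mpoly K[N]}.
Implicit Types (A B : {set 'I_N}) (z : 'I_N) (f u : S) (P Q : prime_idealr S).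

Lemma size_upoly_addX (z : 'I_N) (c : S) : c != 0 ->
  (1 < size (upoly z (1 + 'X_z * c)))%N.
Proof.
move=> c0; rewrite rmorphD rmorph1 rmorphM /= upolyX eqxx mulrC.
have d0 : upoly z c != 0 by rewrite -(rmorph0 (upoly z)) (inj_eq (@upoly_inj _ _ z)).
have sd : (1 < size (upoly z c * 'X)%R)%N.
  by rewrite size_mulX // ltnS lt0n size_poly_eq0.
by rewrite addrC size_polyDl // size_poly1.
Qed.

(** Let A be a maximal independent set, a one of its elements, c a denominator
    as in [clear_denominators] and G = 1 + X_a c.  The ideal P + (G) meets
    K[A - a] only in 0: if b = v G modulo P with b in K[A - a], an integral
    equation of c^e v, homogenised by powers of G, shows that G divides
    (c^e b)^m in K[A]; as G is coprime to c it divides b^m, which is impossible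
    for a nonzero b since G has positive degree in X_a.  A prime containing
    P + (G) and avoiding the nonzero elements of K[A - a] does the job. *)
Lemma prime_above P : (0 < trdeg P)%N ->
  exists Q, [/\ {subset P <= Q}, ~ {subset Q <= P} & (trdeg P <= (trdeg Q).+1)%N].
Proof.
have [A [iA cA]] := trdeg_indep P; rewrite -cA => /card_gt0P[a aA].
have [E [g gP]] := prime_kernel P.
have iA' : indep (ker_prime g) A := eq_indep gP iA.
have maxA z : z \notin A -> ~ indep (ker_prime g) (z |: A).
  move=> zA /(eq_indep (fun u => esym (gP u))).
  exact: trdeg_max.
have [C [CP clr]] := clear_denominators iA' maxA.
pose c := retract A C; pose G : S := 1 + 'X_a * c.
have c0 : c != 0 by apply: contraNneq CP => c0; rewrite -/c c0 ker_primeE rmorph0.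
have sG : (1 < size (upoly a G))%N := size_upoly_addX a c0.
have retc : retract A c = c by rewrite retractK.
have retG : retract A G = G.
  by rewrite rmorphD rmorph1 rmorphM /= retc retractX aA.
have G0 : G != 0 by apply/eqP => G0; move: sG; rewrite G0 rmorph0 size_poly0.
have subA : A :\ a \subset A by apply: subD1set.
pose I : {pred S} := fun u => `[< exists v q, q \in P /\ u = v * G + q >].
pose M u := retract (A :\ a) u = u /\ u != 0.
(* G and c are coprime since G - X_a c = 1. *)
have GcoC x k h : c ^+ k * x = G * h -> exists h', x = G * h'.
  elim: k h => [|k IH] h; first by rewrite expr0 mul1r => ->; exists h.
  move=> ckx; apply: (IH (c ^+ k * x - 'X_a * h)).
  rewrite mulrBr [G * ('X_a * h)]mulrCA -ckx {1}/G exprS !mulrDl mul1r !mulrA.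
  by rewrite addrK.
have IM u : u \in I -> ~ M u.
  move=> /asboolP[v [q [qP uE]]] [retu u0].
  have [e [r r_monic /rootP rv]] := clr v.
  pose m := (size r).-1.
  have mE : size r = m.+1 by rewrite /m prednK // size_poly_gt0 monic_neq0.
  have retAu : retract A u = u by rewrite -retu retract_sub.
  (* The terms of the integral equation of c^e v, multiplied by G^m and with
     v G replaced by u. *)
  pose F i := retract A r`_i * G ^+ (m - i) * (c ^+ e * u) ^+ i.
  have retF i : retract A (F i) = F i.
    by rewrite !rmorphM !rmorphXn /= rmorphM rmorphXn /= retractK retG retc retAu.
  have F0 : \sum_(i < m.+1) F i = 0.
    have retsum : retract A (\sum_(i < m.+1) F i) = \sum_(i < m.+1) F i.
      by rewrite rmorph_sum; apply: eq_bigr => i _ /=.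
    rewrite -retsum; apply: iA'; rewrite retsum ker_primeE rmorph_sum.
    suff -> : \sum_(i < m.+1) g (F i) = g G ^+ m *
        (map_poly (g \o retract A) r).[g (c ^+ e * v)] by rewrite rv mulr0.
    rewrite (@horner_coef_wide _ m.+1) -?mE ?size_poly // mE mulr_sumr.
    apply: eq_bigr => i _.
    have im : (i <= m)%N by rewrite -ltnS.
    rewrite coef_map /= !rmorphM !rmorphXn rmorphM rmorphXn.
    have -> : g u = g v * g G.
      by move: qP; rewrite uE rmorphD rmorphM gP ker_primeE => /eqP->; rewrite addr0.
    have alg (a0 x y w : E) :
        a0 * w ^+ (m - i) * (x * (y * w)) ^+ i = w ^+ m * (a0 * (x * y) ^+ i).
      have -> : w ^+ m = w ^+ (m - i) * w ^+ i by rewrite -exprD subnK.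
      rewrite [x * _]mulrA exprMn.
      by rewrite [a0 * w ^+ _]mulrC [(x * y) ^+ i * _]mulrC mulrACA.
    exact: alg.
  have [h hE] : exists h, (c ^+ e * u) ^+ m = G * h.
    exists (- \sum_(i < m) retract A r`_i * G ^+ (m - i).-1 * (c ^+ e * u) ^+ i).
    rewrite mulrN; apply/eqP; rewrite -subr_eq0 opprK addrC; apply/eqP.
    rewrite -[RHS]F0 big_ord_recr /=; congr (_ + _).
      rewrite mulr_sumr; apply: eq_bigr => i _; rewrite /F.
      have -> : (m - i = (m - i).-1.+1)%N by rewrite prednK // subn_gt0.
      by rewrite /= exprS !mulrA [G * _]mulrC.
    rewrite /F subnn expr0 mulr1 -[r`_m]/(lead_coef r) (monicP r_monic).
    by rewrite rmorph1 mul1r.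
  move: hE; rewrite exprMn -exprM => /GcoC[h' uG].
  have um0 : u ^+ m != 0 by rewrite expf_neq0.
  have h'0 : h' != 0 by apply: contraNneq um0 => h'0; rewrite uG h'0 mulr0.
  have u'h0 : upoly a h' != 0.
    by rewrite -(rmorph0 (upoly a)) (inj_eq (@upoly_inj _ _ a)).
  have u'G0 : upoly a G != 0.
    by rewrite -(rmorph0 (upoly a)) (inj_eq (@upoly_inj _ _ a)).
  have retum : retract (A :\ a) (u ^+ m) = u ^+ m by rewrite rmorphXn /= retu.
  have uGp : (u ^+ m)%:P = upoly a G * upoly a h'.
    have aA' : a \notin A :\ a by rewrite setD11.
    by have := upoly_retract (u ^+ m) aA'; rewrite retum uG rmorphM => <-.
  have s1 : size (upoly a G * upoly a h')%R = 1%N by rewrite -uGp size_polyC um0.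
  have := size_mul u'G0 u'h0; rewrite s1 => sz.
  have h'gt0 : (0 < size (upoly a h'))%N by rewrite size_poly_gt0.
  have arith x y : 1%N = (x + y).-1 -> (1 < x)%N -> (0 < y)%N -> False.
    by case: x y => [|[|x]] // [|y] //; rewrite addSn addnS.
  exact: (arith _ _ sz sG h'gt0).
have PI : {subset P <= I}.
  by move=> q qP; apply/asboolP; exists 0, q; rewrite mul0r add0r.
have [|v|||Q [IQ QM]] := @prime_avoiding S I M _ _ _ _ IM.
- exact/PI/idealr0.
- move=> x y /asboolP[v1 [q1 [q1P ->]]] /asboolP[v2 [q2 [q2P ->]]].
  apply/asboolP; exists (v * v1 + v2), (v * q1 + q2).
  by rewrite rpredD ?idealMr // mulrDr mulrDl !mulrA addrACA.
- by split; rewrite ?rmorph1 ?oner_eq0.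
- by move=> u v [ru u0] [rv v0]; split; rewrite ?mulf_neq0 // rmorphM /= ru rv.
exists Q; split.
- by move=> q /PI/IQ.
- have GQ : G \in Q.
    by apply/IQ/asboolP; exists 1, 0; rewrite mul1r addr0 idealr0.
  by move=> /(_ _ GQ) GP; case/eqP: G0; rewrite -retG; apply: iA; rewrite retG.
- have iQ : indep Q (A :\ a).
    move=> f fQ; apply/eqP; apply: contrapT => /negP f0.
    by apply: (QM _ fQ); split; rewrite ?retractK.
  by move/leq_trdeg: iQ; rewrite [#|A|](cardsD1 a) aA add1n ltnS.
Qed.

Lemma prime_chain_above k P : (k <= trdeg P)%N ->
  exists p, p 0%N = P /\ prime_chain k p.
Proof.
elim: k P => [|k IH] P kP; first by exists (fun=> P).
have [Q [PQ QP tQ]] := prime_above (leq_ltn_trans (leq0n k) kP).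
have [|p [p0 hp]] := IH Q; first by rewrite -ltnS; apply: leq_trans tQ.
exists (fun i => if i is j.+1 then p j else P); split=> // -[_|i]; first by rewrite p0.
by rewrite ltnS => /hp.
Qed.

Section PartialEvaluation.
Variables (E : idomainType) (g : {rmorphism S -> E}).

(** The kernel is the extension to the whole ring of the contraction of the
    prime to K[B], and it grows with B. *)
Definition peval B : S -> {mpoly E[N]} :=
  mmap (@mpolyC N E \o (g \o @mpolyC N K))
       (fun i => if i \in B then (g 'X_i)%:MP else 'X_i).
HB.instance Definition _ B := GRing.RMorphism.on (peval B).

Lemma pevalC B c : peval B c%:MP = (g c%:MP)%:MP.
Proof. by rewrite /peval mmapC. Qed.

Lemma pevalX B i : peval B 'X_i = if i \in B then (g 'X_i)%:MP else 'X_i.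
Proof. by rewrite /peval mmapX mmap1U. Qed.

Lemma peval_retract B A f : A \subset B ->
  peval B (retract A f) = (g (retract A f))%:MP.
Proof.
move=> /subsetP AB; apply: (@mpoly_hom_ext _ _ _
  (peval B \o retract A) (@mpolyC N E \o (g \o retract A))) => [c|i] /=.
  by rewrite retractC pevalC.
by rewrite retractX; case: ifP => [/AB iB|]; rewrite ?rmorph0 // pevalX iB.
Qed.

Lemma peval_full f : peval setT f = (g f)%:MP.
Proof. by rewrite -{1}(retractT f) peval_retract // retractT. Qed.

Lemma peval_sub A B f : A \subset B -> peval A f = 0 -> peval B f = 0.
Proof.
move=> /subsetP AB fA.
pose ev : {mpoly E[N]} -> {mpoly E[N]} :=
  mmap (@mpolyC N E) (fun i => if i \in B then (g 'X_i)%:MP else 'X_i).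
have <- : ev (peval A f) = peval B f.
  pose ev' : {rmorphism {mpoly E[N]} -> {mpoly E[N]}} := mmap (@mpolyC N E)
    (fun i => if i \in B then (g 'X_i)%:MP else 'X_i).
  apply: (@mpoly_hom_ext _ _ _ (ev' \o peval A) (peval B)) => [c|i] /=.
    by rewrite !pevalC mmapC.
  rewrite !pevalX; case: ifP => [/AB ->|_]; first by rewrite mmapC.
  by rewrite mmapX mmap1U.
by rewrite fA /ev raddf0.
Qed.

(** Adjoining z to B enlarges the kernel: a relation between z and A modulo the
    prime has coefficients in K[A], none of which is killed before z is
    evaluated. *)
Lemma peval_new A B z f : indep (ker_prime g) A -> z \notin B -> A \subset B ->
  peval B (retract (z |: A) f) = 0 -> retract (z |: A) f = 0.
Proof.
move=> iA zB AB pf0; have zA : z \notin A by apply: contra zB; apply: (subsetP AB).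
pose ex : {rmorphism {mpoly E[N]} -> {poly E}} := mmap (@polyC E)
    (fun i => if i == z then 'X else 0).
have key : ex (peval B (retract (z |: A) f))
    = map_poly g (upoly z (retract (z |: A) f)).
  apply: (@mpoly_hom_ext _ _ _ (ex \o (peval B \o retract (z |: A)))
     (map_poly g \o (upoly z \o retract (z |: A)))) => [c|i] /=.
    by rewrite retractC pevalC upolyC mmapC map_polyC.
  rewrite retractX !inE; case: (eqVneq i z) => [->|iz] /=.
    by rewrite pevalX (negPf zB) upolyX eqxx mmapX mmap1U eqxx map_polyX.
  case: ifP => iA'; rewrite ?rmorph0 //.
  by rewrite pevalX (subsetP AB _ iA') upolyX (negPf iz) mmapC map_polyC.
rewrite pf0 rmorph0 in key.
apply: (@upoly_inj _ _ z); rewrite rmorph0; apply/polyP => i; rewrite coef0.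
rewrite -retract_coef //; apply: iA; rewrite retract_coef // ker_primeE.
by rewrite -coef_map -key coef0.
Qed.

End PartialEvaluation.

(** Evaluate the variables outside a maximal independent set A one after the
    other; the kernels form the chain. *)
Lemma prime_chain_below P :
  exists p, prime_chain (N - trdeg P) p /\ p (N - trdeg P)%N =i P.
Proof.
have [A [iA cA]] := trdeg_indep P.
have [E [g gP]] := prime_kernel P.
have iA' : indep (ker_prime g) A := eq_indep gP iA.
pose s := enum (~: A); pose B k := A :|: [set z in take k s].
have szs : size s = (N - trdeg P)%N.
  by rewrite -cardE -cA cardsCs setCK card_ord.
have [p pE] : exists p : nat -> prime_idealr S,
    forall k u, (u \in p k) = (peval g (B k) u == 0).
  by exists (fun k => ker_prime (peval g (B k))).
rewrite -szs; exists p; split.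
  move=> i lti; split.
    move=> u; rewrite !pE => /eqP u0; apply/eqP; apply: peval_sub u0.
    apply: setUS; apply/subsetP => z; rewrite !inE (take_nth z lti) mem_rcons inE.
    by move->; rewrite orbT.
  have [z0 _] : exists z, z \in s.
    by case: (s) lti => // z s' _; exists z; rewrite mem_head.
  pose z := nth z0 s i; have zs : z \in s by rewrite mem_nth.
  have zA : z \notin A by move: zs; rewrite mem_enum inE.
  have us : uniq s by apply: enum_uniq.
  have zB : z \notin B i.
    rewrite !inE negb_or zA /=; apply/negP => zi.
    have /(nth_uniq z0) : uniq s := us.
    have := index_mem z (take i s); rewrite zi size_takel ?(ltnW lti) // => ix.
    move/(_ (index z (take i s)) i (ltn_trans ix lti) lti).
    rewrite -(nth_take z0 ix s) nth_index // eqxx => /esym/eqP ixi.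
    by rewrite ixi ltnn in ix.
  have zB1 : z \in B i.+1 by rewrite !inE (take_nth z0 lti) mem_rcons mem_head orbT.
  have depz : ~ indep P (z |: A) by apply: trdeg_max.
  have [f [fP f0]] := dependentP depz.
  move=> /(_ (retract (z |: A) f)); rewrite !pE => h.
  case/eqP: f0; apply: (peval_new iA' zB); first exact: subsetUl.
  apply/eqP/h; rewrite peval_retract.
    by move: fP; rewrite gP ker_primeE => /eqP->; rewrite rmorph0.
  by rewrite subUset sub1set zB1 subsetUl.
move=> u; rewrite pE.
have -> : B (size s) = setT.
  by apply/setP => z; rewrite /B take_size !inE mem_enum inE; case: (z \in A).
by rewrite peval_full mpolyC_eq0 gP.
Qed.

Lemma eq_trdeg (P Q : {pred S}) : P =i Q -> trdeg P = trdeg Q.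
Proof.
move=> PQ; apply/eqP; rewrite eqn_leq; apply/andP; split; apply: trdeg_leq => A.
  by move/(eq_indep PQ)/leq_trdeg.
by move/(eq_indep (fun u => esym (PQ u)))/leq_trdeg.
Qed.

(** The sum of height and transcendence degree is N: chains below P have length
    at most [N - trdeg P] because [trdeg] drops at each step and never
    exceeds N. *)
Lemma prime_height_trdeg P : prime_height P (N - trdeg P).
Proof.
split; first exact: prime_chain_below.
move=> k p hp pk; rewrite leq_subRL ?trdeg_leqN // -(eq_trdeg pk).
exact: leq_trans (trdeg_chain hp) (trdeg_leqN _).
Qed.

Lemma prime_height_unique (R : comNzRingType) (P : prime_idealr R) h k :
  prime_height P h -> prime_height P k -> h = k.
Proof.
move=> [[p [hp ph]] hmax] [[q [hq qk]] kmax].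
by apply/eqP; rewrite eqn_leq (kmax _ _ hp ph) (hmax _ _ hq qk).
Qed.

Lemma ideal_height_unique (R : comNzRingType) (I : {pred R}) h k :
  ideal_height I h -> ideal_height I k -> h = k.
Proof.
move=> [[P [IP Ph]] hmin] [[Q [IQ Qk]] kmin].
by apply/eqP; rewrite eqn_leq (kmin _ _ IP Ph) (hmin _ _ IQ Qk).
Qed.

End Chains.

(** * Height and dimension of an ideal in a polynomial ring *)

Section QuotientPrimes.
Variables (R : comNzRingType) (I : idealr R).
Local Notation RI := {ideal_quot I}.
Local Notation pi := (\pi_(RI)%qT).

Lemma prime_pullback (q : prime_idealr RI) :
  exists P : prime_idealr R, forall u, (u \in P) = (pi u \in q).
Proof.
have [E [g gq]] := prime_residue_domain q.
pose f : {rmorphism R -> RI} := pi.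
by exists (ker_prime (g \o f)) => u; rewrite gq.
Qed.

Lemma prime_pushforward (P : prime_idealr R) : {subset I <= P} ->
  exists q : prime_idealr RI, forall u, (pi u \in q) = (u \in P).
Proof.
move=> IP; pose f : {rmorphism R -> RI} := pi.
pose q : {pred RI} := fun x => repr x \in P.
have qE u : (pi u \in q) = (u \in P).
  rewrite -[LHS]/(repr (pi u) \in P) -[X in X \in P](subrK u).
  apply: rpredDl; apply: IP.
  by rewrite Quotient.idealrBE reprK.
have fE u : pi u = f u by [].
have qI : idealr_closed q.
  split.
  - by rewrite -(rmorph0 f) -fE qE idealr0.
  - by rewrite -(rmorph1 f) -fE qE idealr1.
  - move=> a u v; rewrite -[a]reprK -[u]reprK -[v]reprK !fE -rmorphM -rmorphD -!fE !qE.
    by move=> uP vP; rewrite rpredD // idealMr.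
have qprime : prime_idealr_closed q.
  move=> u v; rewrite -[u]reprK -[v]reprK !fE -rmorphM -!fE !qE.
  by rewrite prime_idealrM.
by exists (mk_prime qI qprime).
Qed.

Lemma chain_pullback k (q : nat -> prime_idealr RI) : prime_chain k q ->
  exists p : nat -> prime_idealr R, prime_chain k p /\ {subset I <= p 0%N}.
Proof.
move=> hq; have /choice[p pE] := fun i => prime_pullback (q i).
exists p; split.
  move=> i /hq[sub strict]; split=> [u|h]; first by rewrite !pE; apply: sub.
  by apply: strict => x; rewrite -[x]reprK -!pE; apply: h.
pose f : {rmorphism R -> RI} := pi.
move=> u uI; rewrite pE.
suff -> : pi u = 0 by apply: idealr0.
apply/eqP; rewrite -(rmorph0 f) -[f 0]/(pi 0).
by rewrite -Quotient.idealrBE subr0.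
Qed.

Lemma chain_pushforward k (p : nat -> prime_idealr R) :
  prime_chain k p -> (forall i, {subset I <= p i}) ->
  exists q : nat -> prime_idealr RI, prime_chain k q.
Proof.
move=> hp Ip; have /choice[q qE] := fun i => prime_pushforward (Ip i).
exists q => i /hp[sub strict]; split=> [x|h].
  by rewrite -[x]reprK !qE; apply: sub.
by apply: strict => u; rewrite -!qE; apply: h.
Qed.

End QuotientPrimes.

Section HeightDimension.
Variables (K : fieldType) (N : nat) (I : idealr {mpoly K[N]}) (d : nat).
Hypothesis dimI : krull_dim {ideal_quot I} d.

Lemma krull_dim_trdeg :
  exists P : prime_idealr {mpoly K[N]}, {subset I <= P} /\ (d <= trdeg P)%N.
Proof.
have [[q hq] _] := dimI; have [p [hp Ip]] := chain_pullback hq.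
by exists (p 0%N); split=> //; apply: leq_trans (trdeg_chain hp); rewrite leq_addl.
Qed.

Lemma trdeg_krull_dim (P : prime_idealr {mpoly K[N]}) :
  {subset I <= P} -> (trdeg P <= d)%N.
Proof.
move=> IP; have [p [p0 hp]] := prime_chain_above (leqnn (trdeg P)).
have Ip i : (i <= trdeg P)%N -> {subset I <= p i}.
  elim: i => [|i IH] hi u uI; first by rewrite p0; apply: IP.
  by have [sub _] := hp i hi; apply/sub/IH => //; apply: ltnW.
pose p' i := p (minn i (trdeg P)).
have [||q hq] := @chain_pushforward _ I (trdeg P) p'.
- by move=> i hi; rewrite /p' (minn_idPl hi) (minn_idPl (ltnW hi)); apply: hp.
- by move=> i; apply: Ip; rewrite geq_minr.
by have [_ dmax] := dimI; apply: dmax hq.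
Qed.

Lemma height_krull_dim : ideal_height I (N - d).
Proof.
split.
  have [P [IP dP]] := krull_dim_trdeg; exists P; split=> //.
  have <- : trdeg P = d by apply/eqP; rewrite eqn_leq dP trdeg_krull_dim.
  exact: prime_height_trdeg.
move=> P k IP /prime_height_unique/(_ (prime_height_trdeg P)) ->.
by rewrite leq_sub2l // trdeg_krull_dim.
Qed.

End HeightDimension.

(** * Graphs whose components are paths *)

Section PathOrientations.
Variables (T : finType) (H : graph T).

(** D directs every edge along its path; the strictly increasing rank [rk] is
    there to exclude cycles. *)
Definition path_orientation (D : rel T) (rk : T -> nat) : Prop :=
  [/\ forall x y, adj H x y = D x y || D y x,
      forall x y, D x y -> (rk x < rk y)%N,
      forall x y z, D x y -> D x z -> y = z
    & forall x y z, D x z -> D y z -> x = y].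

Lemma card_edges_orientation D rk : path_orientation D rk ->
  #|edges H| = #|[set p | D p.1 p.2]|.
Proof.
move=> [adjE rkD _ _]; rewrite -(@card_in_imset _ _ (fun p : T * T => [set p.1; p.2])).
  apply: eq_card => e; apply/imsetP/imsetP => -[[x y]]; rewrite !inE /= ?adjE.
    case/orP=> xy ->; first by exists (x, y); rewrite ?inE.
    by exists (y, x); rewrite ?inE //= setUC.
  by move=> xy ->; exists (x, y); rewrite ?inE /= ?adjE ?xy.
move=> [x y] [x' y']; rewrite !inE /= => xy xy' e.
have := set21 x y; have := set22 x y; rewrite e !inE.
have := rkD _ _ xy; have := rkD _ _ xy'.
case: (eqVneq x x') => [-> _ lt /orP[/eqP yx|/eqP->]//|_ _ lt].
  by rewrite yx ltnn in lt.
move=> h /= /eqP xy'E; case/orP: h => /eqP yE.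
  have := rkD _ _ xy'; rewrite yE xy'E in lt *.
  by move=> lt'; have := ltn_trans lt lt'; rewrite ltnn.
by rewrite xy'E yE ltnn in lt.
Qed.

(** The rank of a vertex is its index in the listing of its component, one
    listing being chosen for the representative of each component. *)
Lemma path_graph_orientation :
  {in vertices H, forall x, path_graph (component H x)} ->
  exists D rk, path_orientation D rk.
Proof.
move=> Hpath; have csym : connect_sym (adj H) := sym_connect_sym (@adj_sym _ H).
have /choice[s sP] : forall x, exists s : seq T, x \in vertices H ->
    [/\ uniq s, vertices (component H x) = [set y in s]
      & {in vertices (component H x) &, forall y z, adj (component H x) y z =
           (index z s == (index y s).+1) || (index y s == (index z s).+1)}].
  move=> x; case: (boolP (x \in vertices H)) => [/Hpath[s [_ us vs es]]|_].
    by exists s.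
  by exists [::].
pose r := fingraph.root (adj H); pose rk x := index x (s (r x)).
pose D x y := adj H x y && (rk y == (rk x).+1).
have adjV x y : adj H x y -> x \in vertices H by exact: adj_vertex.
have rV x : x \in vertices H -> r x \in vertices H.
  move=> xV; have : connect (adj H) x (r x) by rewrite connect_root.
  case/connectP=> [[|z p]] /=; first by move=> _ ->.
  case/andP=> xz pth ->; elim: p z x xz pth {xV} => [|w p IH] z x xz /=.
    by move=> _; apply: adjV (_ : adj H z x); rewrite adj_sym.
  by case/andP; apply: IH.
have adj_r x y : adj H x y -> r x = r y.
  by move=> xy; apply/(fingraph.rootP csym)/connect1.
have in_comp x : x \in vertices H -> x \in vertices (component H (r x)).
  by move=> xV; rewrite inE xV csym connect_root.
have in_s x : x \in vertices H -> x \in s (r x).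
  move=> xV; have [_ vs _] := sP _ (rV _ xV).
  by have := in_comp _ xV; rewrite vs inE.
have stepE x y : adj H x y -> (rk y == (rk x).+1) || (rk x == (rk y).+1).
  move=> xy; have xV := adjV _ _ xy.
  have yV : y \in vertices H by apply: adjV (_ : adj H y x); rewrite adj_sym.
  have [_ _ es] := sP _ (rV _ xV); have xC := in_comp _ xV.
  have yC : y \in vertices (component H (r x)) by rewrite (adj_r _ _ xy) in_comp.
  rewrite /rk -(adj_r _ _ xy) -es // /= /component_adj /= xy.
  by rewrite andTb; apply/andP; split.
have rk_inj x y : x \in vertices H -> y \in vertices H ->
    r x = r y -> rk x = rk y -> x = y.
  move=> xV yV rxy; rewrite /rk -rxy => ixy.
  rewrite -(nth_index x (in_s _ xV)) ixy nth_index // rxy; exact: in_s.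
exists D, rk; split.
- move=> x y; rewrite /D [adj H y x]adj_sym -andb_orr.
  by case xy : (adj H x y); rewrite // stepE.
- by move=> x y /andP[_ /eqP->].
- move=> x y z /andP[xy /eqP ky] /andP[xz /eqP kz].
  apply: rk_inj; rewrite ?ky ?kz // -?(adj_r _ _ xy) -?(adj_r _ _ xz) //.
    by apply: adjV (_ : adj H y x); rewrite adj_sym.
  by apply: adjV (_ : adj H z x); rewrite adj_sym.
- move=> x y z /andP[xz /eqP kx] /andP[yz /eqP ky].
  apply: rk_inj; first exact: adjV xz; first exact: adjV yz.
    by rewrite (adj_r _ _ xz) (adj_r _ _ yz).
  by apply/eqP; rewrite -eqSS -kx -ky.
Qed.

(** The component of x is listed by following D from the starting point of the
    path through x. *)
Lemma orientation_path_graph D rk : path_orientation D rk ->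
  {in vertices H, forall x, path_graph (component H x)}.
Proof.
move=> [adjE rkD Dfun Dinj] x xV.
have csym : connect_sym (adj H) := sym_connect_sym (@adj_sym _ H).
pose next y := odflt y [pick z | D y z].
have nextD y z : D y z -> next y = z.
  rewrite /next; case: pickP => [w /= yw yz|/(_ z) -> //]; exact: Dfun yw yz.
have nextP y : next y != y -> D y (next y).
  by rewrite /next; case: pickP => [w //|_]; rewrite eqxx.
have rk_next y k : (rk y <= rk (iter k next y))%N.
  elim: k => //= k IH; apply: leq_trans IH _; move: (iter k next y) => z.
  by case: (eqVneq (next z) z) => [->//|/nextP/rkD/ltnW].
have rk_conn y z : fconnect next y z -> (rk y <= rk z)%N.
  by case/connectP=> p /fpathP[k ->] ->; rewrite last_traject rk_next.
(* The start of the path through x: a vertex leading to x whose orbit is as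
   large as possible cannot have a predecessor. *)
have [r [rx rroot]] : exists r, fconnect next r x /\ forall y, ~~ D y r.
  pose P0 := [pred z | fconnect next z x].
  have P0x : P0 x by rewrite /= connect0.
  case: (@arg_maxnP _ x P0 (fun z => #|fconnect next z|) P0x) => r rx rmax.
  exists r; split=> // y; apply/negP => yr.
  have yrc : fconnect next y r by rewrite -(nextD _ _ yr) fconnect1.
  have le : (#|fconnect next y| <= #|fconnect next r|)%N.
    exact: rmax y (connect_trans yrc rx).
  move: le; rewrite leqNgt => /negP; apply.
  apply: proper_card; apply/properP; split.
    by apply/subsetP => z; rewrite !inE; apply: connect_trans.
  exists y; rewrite !inE ?connect0 //; apply/negP => /rk_conn.
  by rewrite leqNgt rkD.
pose s := orbit next r.
have us : uniq s by apply: orbit_uniq.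
have mem_s y : (y \in s) = fconnect next r y by rewrite fconnect_orbit.
have nth_s k : (k < size s)%N -> nth r s k = iter k next r.
  by rewrite size_orbit => ks; rewrite nth_traject.
have index_lt y : y \in s -> (index y s < size s)%N by rewrite index_mem.
have iter_index y : y \in s -> iter (index y s) next r = y.
  by move=> ys; rewrite -nth_s ?index_mem // nth_index.
have s_next y : y \in s -> next y \in s.
  by rewrite !mem_s => /connect_trans; apply; apply: fconnect1.
have s_pred y z : D y z -> z \in s -> y \in s /\ index z s = (index y s).+1.
  move=> yz zs; have := iter_index _ zs; have := index_lt _ zs.
  case: (index z s) => [_ /= rz|k ks kz]; first by rewrite -rz (negPf (rroot y)) in yz.
  have k_lt : (k < size s)%N by apply: ltnW.
  have Dk : D (iter k next r) z.
    rewrite -kz iterS; apply: nextP; rewrite -iterS -!nth_s //.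
    by rewrite nth_uniq // -[X in _ != X]addn0 -addn1 eqn_add2l.
  have <- : iter k next r = y by apply: Dinj Dk yz.
  by rewrite -nth_s // mem_nth // index_uniq.
have s_conn y : y \in s -> connect (adj H) r y.
  rewrite mem_s; apply: connect_sub => {}y z /= /eqP <-.
  case: (eqVneq (next y) y) => [->|/nextP yn]; first exact: connect0.
  by apply: connect1; rewrite adjE yn.
have s_closed : closed (adj H) (mem s).
  apply: intro_closed => // y z; rewrite adjE => /orP[yz ys|zy ys].
    by rewrite -(nextD _ _ yz) s_next.
  by have [] := s_pred _ _ zy ys.
have xs : x \in s by rewrite mem_s.
have memC y : (y \in component_vertices H x) = (y \in s).
  rewrite inE; apply/andP/idP => [[yV xy]|ys].
    by rewrite -(closed_connect s_closed xy).
  have xy : connect (adj H) x y by rewrite (connect_trans _ (s_conn _ ys)) // csym s_conn.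
  split=> //; case/connectP: xy => p.
  elim/last_ind: p => [_ -> //|p z _]; rewrite rcons_path last_rcons => /andP[_ e] ->.
  by apply: adj_vertex (_ : adj H z (last x p)); rewrite adj_sym.
exists s; split=> //.
- by rewrite -size_eq0 -lt0n; apply: leq_ltn_trans (index_lt _ xs).
- by apply/setP => y; rewrite /= memC inE.
- move=> y z /=; rewrite !memC => ys zs; rewrite /component_adj /= !memC ys zs !andbT.
  have DE u v : u \in s -> v \in s -> D u v = (index v s == (index u s).+1).
    move=> us0 vs; apply/idP/eqP => [uv|iv]; first by have [] := s_pred _ _ uv vs.
    have vE : v = next u by rewrite -(iter_index _ vs) iv iterS iter_index.
    rewrite vE; apply: nextP; rewrite -vE; apply/eqP => vu.
    by move: iv; rewrite vu => /eqP; rewrite -[X in X == _]addn0 -addn1 eqn_add2l.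
  by rewrite adjE !DE.
Qed.

End PathOrientations.

(** * Independent variables along a semi-path *)

Section EdgeBinomials.
Variables (K : fieldType) (n : nat).
Local Notation S := {mpoly K[n + n]}.
Implicit Types (i j k l : 'I_n).

(** Exponent of the monomial x_i y_j. *)
Definition mxy (i j : 'I_n) : 'X_{1..n + n} :=
  (U_(lshift n i) + U_(rshift n j))%MM.

Lemma mxy_l i j k : mxy i j (lshift n k) = (i == k).
Proof. by rewrite mnmDE !mnm1E eq_lshift eq_rlshift addn0. Qed.

Lemma mxy_r i j k : mxy i j (rshift n k) = (j == k).
Proof. by rewrite mnmDE !mnm1E eq_rshift eq_lrshift. Qed.

Lemma mxy_inj i j k l : mxy i j = mxy k l -> i = k /\ j = l.
Proof.
move=> e; split.
  have := congr1 (fun m : 'X_{1..n + n} => m (lshift n k)) e.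
  by rewrite !mxy_l eqxx; case: eqP.
have := congr1 (fun m : 'X_{1..n + n} => m (rshift n l)) e.
by rewrite !mxy_r eqxx; case: eqP.
Qed.

Lemma eq_mxy i j k l : (mxy i j == mxy k l) = (i == k) && (j == l).
Proof.
apply/eqP/andP => [/mxy_inj[-> ->]|[/eqP-> /eqP->] //]; by rewrite !eqxx.
Qed.

Lemma mdeg_mxy i j : mdeg (mxy i j) = 2%N.
Proof. by rewrite mdegD !mdeg1. Qed.

Lemma edge_binomialE i j :
  edge_binomial K i j = 'X_[mxy i j] - 'X_[mxy j i].
Proof. by rewrite /edge_binomial /varx /vary -!mpolyXD. Qed.

Lemma edge_binomial_coef i j m :
  (edge_binomial K i j)@_m = (mxy i j == m)%:R - (mxy j i == m)%:R.
Proof. by rewrite edge_binomialE mcoeffB !mcoeffX. Qed.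

Lemma edge_binomialC i j : edge_binomial K j i = - edge_binomial K i j.
Proof. by rewrite !edge_binomialE opprB. Qed.

Lemma edge_binomial_neq0 i j : i != j -> edge_binomial K i j != 0.
Proof.
move=> ij; apply/eqP => /(congr1 (mcoeff (mxy i j))).
rewrite edge_binomial_coef eqxx eq_mxy eq_sym (negPf ij) mcoeff0 subr0.
by move/eqP; rewrite oner_eq0.
Qed.

End EdgeBinomials.

Section SemiPathBound.
Variables (K : fieldType) (n : nat) (P : prime_idealr {mpoly K[n + n]}).
Variables (A : {set 'I_(n + n)}) (D : rel 'I_n) (rk : 'I_n -> nat).
Hypothesis indA : indep P A.
Hypothesis D_rk : forall i j, D i j -> (rk i < rk j)%N.
Hypothesis D_fun : forall i j k, D i j -> D i k -> j = k.
Hypothesis D_inj : forall i j k, D i k -> D j k -> i = j.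
Hypothesis DP : forall i j, D i j -> edge_binomial K i j \in P.

Implicit Types (i j k l : 'I_n).

Let par i j := edge_binomial K i j \in P.
Let nonzero i := (varx K i \notin P) || (vary K i \notin P).
Let double i := (lshift n i \in A) && (rshift n i \in A).
(** Records that the extra variable in A contributed by an earlier vertex l of
    the path has not yet been compensated by a vertex without variables in A.
    Comparing ranks keeps l from being a later vertex. *)
Let tight i := nonzero i &&
  [exists l, [&& double l, (rk l <= rk i)%N & par l i]].
Let deg i := ((lshift n i \in A) + (rshift n i \in A))%N.

(** Two vectors of the plane proportional to the same nonzero vector are
    proportional. *)
Lemma par_trans i j k : nonzero j -> par i j -> par j k -> par i k.
Proof.
rewrite /par /edge_binomial => nj ij jk.
have key v : v * varx K i * vary K k - v * varx K k * vary K i \in P ->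
    v \notin P -> par i k.
  rewrite -!mulrA -mulrBr prime_idealrM => /orP[vP|//].
  by rewrite vP.
case/orP: nj => [xj|yj].
  apply: key xj.
  have -> : varx K j * varx K i * vary K k - varx K j * varx K k * vary K i =
     varx K i * (varx K j * vary K k - varx K k * vary K j)
     + varx K k * (varx K i * vary K j - varx K j * vary K i) by ring.
  by rewrite rpredD ?idealMr.
apply: key yj.
have -> : vary K j * varx K i * vary K k - vary K j * varx K k * vary K i =
   vary K k * (varx K i * vary K j - varx K j * vary K i)
   + vary K i * (varx K j * vary K k - varx K k * vary K j) by ring.
by rewrite rpredD ?idealMr.
Qed.

Lemma indep_var v : v \in A -> 'X_v \notin P.
Proof.
move=> vA; apply/negP => vP; have retv : retract A 'X_v = 'X_v :> {mpoly K[n + n]}.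
  by rewrite retractX vA.
have := indA (f := 'X_v); rewrite retv => /(_ vP) /(congr1 (mcoeff U_(v)%MM)).
by rewrite mcoeffX eqxx mcoeff0 => /eqP; rewrite oner_eq0.
Qed.

(** Otherwise the binomial of i and j would be a nonzero relation between
    variables in A. *)
Lemma double_par i j : double i -> double j -> par i j -> i = j.
Proof.
move=> /andP[xi yi] /andP[xj yj] ij; apply/eqP; apply: contraTT (ij) => nij.
have ret : retract A (edge_binomial K i j) = edge_binomial K i j.
  by rewrite /edge_binomial rmorphB !rmorphM /= !retractX xi yi xj yj.
apply/negP => ijP; have := indA (f := edge_binomial K i j).
by rewrite ret => /(_ ijP) /eqP; rewrite (negPf (edge_binomial_neq0 K nij)).
Qed.

Lemma deg_nonzero i : (0 < deg i)%N -> nonzero i.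
Proof.
rewrite /deg /nonzero addn_gt0 !lt0b /varx /vary.
by case/orP => /indep_var ->; rewrite ?orbT.
Qed.

Lemma double_tight i : double i -> tight i.
Proof.
move=> di; rewrite /tight deg_nonzero; last by move: di; rewrite /deg => /andP[->].
apply/existsP; exists i; rewrite di leqnn /par edge_binomialE subrr.
exact: idealr0.
Qed.

(** Tightness passes from j to i as soon as i has a variable in A; if i has
    both, then j cannot be tight, since i and the vertex witnessing this would
    be proportional. *)
Lemma deg_step j i : D j i -> (deg i + tight j <= 1 + tight i)%N.
Proof.
move=> ji; have [di|ndi] := boolP (double i).
  rewrite (double_tight di) /deg; move: (di); rewrite /double => /andP[-> ->].
  suff -> : tight j = false by [].
  apply/negP => /andP[nj /existsP[l /and3P[dl rkl lj]]].
  have li := double_par dl di (par_trans nj lj (DP ji)).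
  by move: rkl; rewrite li leqNgt D_rk.
have deg1 : (deg i <= 1)%N by move: ndi; rewrite /double /deg; do 2!case: (_ \in A).
case tj: (tight j); last by rewrite addn0; apply: leq_trans deg1 _; rewrite leq_addr.
have [->|deg_gt0] := posnP (deg i); first by rewrite add0n leq_addr.
suff -> : tight i by rewrite leq_add2r.
case/andP: tj => nj /existsP[l /and3P[dl rkl lj]].
rewrite /tight (deg_nonzero deg_gt0); apply/existsP; exists l.
rewrite dl (leq_trans rkl (ltnW (D_rk ji))) /=.
exact: par_trans nj lj (DP ji).
Qed.

Lemma deg_root i : (deg i <= 1 + tight i)%N.
Proof.
have [di|ndi] := boolP (double i).
  by rewrite (double_tight di) /deg leq_add // leq_b1.
apply: leq_trans (leq_addr _ _).
by move: ndi; rewrite /double /deg; do 2!case: (_ \in A).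
Qed.

(** Summing [deg_step] and [deg_root] over all vertices, the tightness of a
    vertex with a successor cancels, and that of a vertex without one counts
    for at most 1.  There are n - |D| vertices without successor. *)
Lemma card_indep_semi_path : (#|A| + #|[set p | D p.1 p.2]| <= n + n)%N.
Proof.
have cardA : #|A| = (\sum_i deg i)%N.
  rewrite -sum1_card big_mkcond big_split_ord /= -big_split /=.
  by apply: eq_bigr => i _; rewrite /deg; do 2!case: (_ \in A).
have outD i : #|[pred k | D i k]| = [exists k, D i k] :> nat.
  case: existsP => [[k ik]|nk].
    rewrite (eq_card (B := pred1 k)) ?card1 // => l; rewrite !inE.
    by apply/idP/eqP => [il|->//]; apply: D_fun il ik.
  by apply: eq_card0 => k; rewrite !inE; apply/negP => ik; apply: nk; exists k.
have cardD : #|[set p | D p.1 p.2]| = (\sum_i #|[pred k | D i k]|)%N.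
  rewrite -sum1_card; under [RHS]eq_bigr do rewrite -sum1_card.
  by rewrite pair_big_dep /=; apply: eq_bigl => -[i k]; rewrite !inE.
have inT i : (deg i + \sum_(j | D j i) tight j <= 1 + tight i)%N.
  have [/existsP[j ji]|/existsPn nj] := boolP [exists j, D j i].
    rewrite (big_pred1 j) ?deg_step // => k.
    by apply/idP/eqP => [ki|->//]; apply: D_inj ki ji.
  by rewrite big_pred0 ?addn0 ?deg_root // => j; apply: negbTE; apply: nj.
have le1 : (\sum_i deg i + \sum_i tight i * #|[pred k | D i k]| <= n + \sum_i tight i)%N.
  have -> : (\sum_i tight i * #|[pred k | D i k]| = \sum_i \sum_(j | D j i) tight j)%N.
    rewrite (exchange_big_dep xpredT) //=; apply: eq_bigr => i _.
    by rewrite sum_nat_const mulnC.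
  have -> : (n + \sum_i tight i = \sum_i (1 + tight i))%N.
    by rewrite big_split /= sum_nat_const card_ord muln1.
  by rewrite -big_split; apply: leq_sum => i _; apply: inT.
have le2 : (\sum_i tight i + \sum_i #|[pred k | D i k]|
    <= \sum_i tight i * #|[pred k | D i k]| + n)%N.
  have sum1n : (\sum_(i < n) 1)%N = n by rewrite sum_nat_const card_ord muln1.
  rewrite -[X in (_ <= _ + X)%N]sum1n -!big_split; apply: leq_sum => i _ /=; rewrite outD.
  by case: (tight i); case: [exists k, D i k].
rewrite cardA cardD; lia.
Qed.

End SemiPathBound.

(** * Ideals given by generators *)

Section GeneratedIdeals.
Variable R : comNzRingType.
Implicit Types (s t : seq R) (I : {pred R}).

Lemma ideal_gen0 s : 0 \in ideal_gen s.
Proof.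
by apply/asboolP; exists (fun=> 0); rewrite big1 // => i _; rewrite mul0r.
Qed.

Lemma ideal_gen_closed s a : {in ideal_gen s &, forall u v, a * u + v \in ideal_gen s}.
Proof.
move=> u v /asboolP[b ->] /asboolP[c ->]; apply/asboolP.
exists (fun i => a * b i + c i); rewrite mulr_sumr -big_split.
by apply: eq_bigr => i _; rewrite mulrDl mulrA.
Qed.

Lemma mem_ideal_gen s x : x \in s -> x \in ideal_gen s.
Proof.
move=> xs; apply/asboolP; have ltx : (index x s < size s)%N by rewrite index_mem.
exists (fun i => (i == Ordinal ltx)%:R).
rewrite (bigD1 (Ordinal ltx)) //= eqxx mul1r nth_index // big1 ?addr0 // => i.
by move/negPf->; rewrite mul0r.
Qed.

Lemma ideal_gen_min s I :
  0 \in I -> (forall a, {in I &, forall u v, a * u + v \in I}) ->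
  {subset s <= I} -> {subset ideal_gen s <= I}.
Proof.
move=> I0 Icl sI _ /asboolP[a ->]; elim/big_ind: _ => // [u v uI vI|i _].
  by rewrite -[u]mul1r; apply: Icl.
by rewrite -[_ * _]addr0; apply: Icl => //; apply/sI/mem_nth.
Qed.

Lemma ideal_gen_sub s t :
  {subset s <= ideal_gen t} -> {subset ideal_gen s <= ideal_gen t}.
Proof. by apply: ideal_gen_min; [apply: ideal_gen0|apply: ideal_gen_closed]. Qed.

Lemma ideal_gen_subset s t : {subset s <= t} -> {subset ideal_gen s <= ideal_gen t}.
Proof. by move=> st; apply: ideal_gen_sub => x /st; apply: mem_ideal_gen. Qed.

Lemma ideal_genMl s a u : u \in ideal_gen s -> a * u \in ideal_gen s.
Proof. by move=> us; rewrite -[_ * _]addr0; apply: ideal_gen_closed (ideal_gen0 s). Qed.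

Lemma regular_sequence_neq0 s : regular_sequence s -> 0 \notin s.
Proof.
move=> [reg one]; apply/negP => s0; have := reg (index 0 s).
rewrite index_mem nth_index // => /(_ s0 1); rewrite mulr0 ideal_gen0 => /(_ isT) h.
by case/negP: one; apply: ideal_gen_subset h => x; apply: mem_take.
Qed.

End GeneratedIdeals.

(** * Regular sequences of monomials *)

Section MonomialSequences.
Variables (K : fieldType) (N : nat).
Implicit Types (m k l : 'X_{1..N}) (s : seq 'X_{1..N}).
Local Notation monomials s := [seq 'X_[m] : {mpoly K[N]} | m <- s].

Lemma monomial_idealP s (u : {mpoly K[N]}) :
  reflect {in msupp u, forall m, has (fun k => (k <= m)%MM) s}
          (u \in ideal_gen (monomials s)).
Proof.
apply: (iffP idP) => [|us].
  pose I : {pred {mpoly K[N]}} :=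
    fun v => all (fun m => has (fun k => (k <= m)%MM) s) (msupp v).
  move=> us; suff : u \in I by move/allP.
  move: u us; apply: ideal_gen_min.
  - by rewrite -[_ \in _]/(all _ _) msupp0.
  - move=> a u v /allP uI /allP vI; apply/allP => m /msuppD_le.
    rewrite mem_cat => /orP[/msuppM_le|/vI//].
    case/allpairsP=> -[k l] [/= _ /uI/hasP[x xs xl] ->]; apply/hasP; exists x => //.
    by apply: lepm_trans xl _; apply: lem_addl.
  - move=> _ /mapP[m ms ->]; apply/allP => k; rewrite msuppX inE => /eqP->.
    by apply/hasP; exists m => //; apply: lepm_refl.
rewrite (mpolyE u) big_seq; elim/big_ind: _ => [|v w vs ws|m mu].
- exact: ideal_gen0.
- by rewrite -[v]mul1r; apply: ideal_gen_closed.
have /hasP[k ks km] := us m mu.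
rewrite -mul_mpolyC -(submK km) mpolyXD; do 2!apply: ideal_genMl.
by apply: mem_ideal_gen; apply: map_f.
Qed.

Definition coprimem m k := [forall v, (m v == 0%N) || (k v == 0%N)].

Lemma coprimem_dvd m k l : coprimem k l -> (k <= m + l)%MM -> (k <= m)%MM.
Proof.
move=> /forallP co /mnm_lepP kml; apply/mnm_lepP => v; have := kml v.
by rewrite mnmDE; case/orP: (co v) => /eqP->; rewrite ?addn0.
Qed.

Lemma regular_monomials s :
  pairwise coprimem s -> 0%MM \notin s -> regular_sequence (monomials s).
Proof.
move=> cop s0; split.
  move=> i; rewrite size_map => lti u; rewrite -map_take (nth_map 0%MM) //.
  move=> /monomial_idealP uXs; apply/monomial_idealP => m mu.
  have /uXs/hasP[k ks kmi] : (m + nth 0%MM s i)%MM \in msupp (u * 'X_[nth 0%MM s i]).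
    by rewrite mcoeff_msupp addmC mcoeffMX -mcoeff_msupp.
  apply/hasP; exists k => //; apply: coprimem_dvd kmi.
  have /(nthP 0%MM)[j] := ks; rewrite size_takel ?(ltnW lti) // => ji <-.
  rewrite nth_take //; move/(pairwiseP 0%MM): cop; apply; rewrite ?inE //.
  exact: ltn_trans ji lti.
apply/negP => /monomial_idealP /(_ 0%MM); rewrite msupp1 inE eqxx => /(_ isT).
case/hasP=> k ks; move/mnm_lepP => k0; case/negP: s0.
suff <- : k = 0%MM by [].
by apply/mnmP => v; have := k0 v; rewrite mnm0E leqn0 => /eqP.
Qed.

(** If a variable X_v divides two of the monomials, m and later k, then m / X_v
    multiplies k into the ideal of the earlier monomials; having degree 1 it
    is not itself in that ideal. *)
Lemma regular_quadratic_monomials s :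
  {in s, forall m, mdeg m = 2%N} -> regular_sequence (monomials s) ->
  pairwise coprimem s.
Proof.
move=> deg2 [reg _]; apply/(pairwiseP 0%MM) => i j; rewrite !inE => lti ltj ij.
apply/forallP => v; apply: contraT; rewrite negb_or -!lt0n => /andP[iv jv].
set m := nth 0%MM s i; set k := nth 0%MM s j.
have um : (U_(v) <= m)%MM by rewrite lep1mP -lt0n.
have uk : (U_(v) <= k)%MM by rewrite lep1mP -lt0n.
have := reg j; rewrite size_map -map_take (nth_map 0%MM) // -/k.
move=> /(_ ltj 'X_[m - U_(v)]).
have -> : 'X_[m - U_(v)] * 'X_[k] = 'X_[k - U_(v)] * 'X_[m] :> {mpoly K[N]}.
  rewrite -!mpolyXD -{1}(submK uk) -{2}(submK um) !addmA; congr 'X_[_].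
  by rewrite [(m - _ + _)%MM]addmC.
have min : 'X_[m] \in ideal_gen [seq 'X_[m] : {mpoly K[N]} | m <- take j s].
  apply: mem_ideal_gen; apply: map_f.
  by rewrite /m -(nth_take _ ij) mem_nth // size_takel // ltnW.
move=> /(_ (ideal_genMl _ min))/monomial_idealP/(_ (m - U_(v))%MM).
rewrite msuppX inE eqxx => /(_ isT)/hasP[l /mem_take ls].
move=> /mnm_lepP lm; have : (mdeg l <= mdeg (m - U_(v))%MM)%N.
  by rewrite !mdegE; apply: leq_sum => w _; apply: lm.
have dm : mdeg m = 2%N by apply: deg2; rewrite mem_nth.
have := congr1 mdeg (submK um); rewrite mdegD mdeg1 dm => h.
by rewrite (deg2 l ls); move: (mdeg _) h => e; lia.
Qed.

End MonomialSequences.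

(** * Initial monomials *)

Section InitialMonomials.
Variables (K : fieldType) (N : nat) (le : rel 'X_{1..N}).
Hypothesis le_order : monomial_order le.
Implicit Types (f : {mpoly K[N]}) (m k : 'X_{1..N}).

Lemma initial_monomial_max f : f != 0 -> exists m,
  [/\ m \in msupp f, {in msupp f, forall k, le k m}
    & initial_monomial le f = 'X_[m]].
Proof.
have [le_refl le_anti le_trans le_total _] := le_order => f0.
exists (last 0%MM (sort le (msupp f))); rewrite /initial_monomial (negPf f0).
have srt : sorted le (sort le (msupp f)) by apply: sort_sorted.
have mem := mem_sort le (msupp f).
have s_gt0 : (0 < size (sort le (msupp f)))%N.
  by rewrite size_sort lt0n size_eq0 msupp_eq0.
rewrite -nth_last; split=> // [|k]; first by rewrite -mem mem_nth // prednK.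
rewrite -mem => /(nthP 0%MM)[i lti <-].
apply: sorted_leq_nth => //; first by rewrite inE prednK.
by rewrite -ltnS prednK.
Qed.

Lemma initial_monomialE f m :
  m \in msupp f -> {in msupp f, forall k, le k m} -> initial_monomial le f = 'X_[m].
Proof.
have [_ le_anti _ _ _] := le_order => mf mmax.
have f0 : f != 0 by apply: contraTneq mf => ->; rewrite msupp0.
have [k [kf kmax ->]] := initial_monomial_max f0.
by congr 'X_[_]; apply: le_anti; rewrite mmax // kmax.
Qed.

Lemma initial_monomialN f : initial_monomial le (- f) = initial_monomial le f.
Proof.
have [->|f0] := eqVneq f 0; first by rewrite oppr0.
have [m [mf mmax ->]] := initial_monomial_max f0.
have supp := perm_mem (msuppN f).
by apply: initial_monomialE => [|k]; rewrite supp //; apply: mmax.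
Qed.

End InitialMonomials.

(** * The quadrics of a binomial edge ideal *)

Section LowestDegree.
Variables (K : fieldType) (N : nat).
Implicit Types (a u : {mpoly K[N]}) (m : 'X_{1..N}).

(** In the lowest degree of u, multiplication by a acts through the constant
    term of a.  This replaces splitting into homogeneous components below. *)
Lemma mcoeffM_lowest d a u m :
  (forall k, (mdeg k < d)%N -> u@_k = 0) -> (mdeg m <= d)%N ->
  (a * u)@_m = a@_0%MM * u@_m.
Proof.
move=> ud md; pose b := a - (a@_0%MM)%:MP.
have b0 : b@_0%MM = 0 by rewrite mcoeffB mcoeffC eqxx mulr1 subrr.
have aE : a = (a@_0%MM)%:MP + b by rewrite addrC subrK.
rewrite {1}aE mulrDl mcoeffD mcoeffCM.
suff -> : (b * u)@_m = 0 by rewrite addr0.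
apply/memN_msupp_eq0/negP => /msuppM_le/allpairsP[[k l] /= [kb lu mE]].
have k0 : (0 < mdeg k)%N.
  rewrite lt0n mdeg_eq0; apply: contraTneq kb => ->.
  by rewrite mcoeff_msupp b0 eqxx.
move: lu; rewrite mcoeff_msupp ud ?eqxx //.
by apply: leq_trans md; rewrite mE mdegD -[X in (X < _)%N]add0n ltn_add2r.
Qed.

End LowestDegree.

Section EdgeIdeal.
Variables (K : fieldType) (n : nat) (G : graph 'I_n).
Local Notation S := {mpoly K[n + n]}.
Local Notation J := (binomial_edge_ideal K G).
Local Notation eb := (fun p : 'I_n * 'I_n => edge_binomial K p.1 p.2).
Implicit Types (i j : 'I_n) (p q : 'I_n * 'I_n).

Lemma edge_binomial_in i j : adj G i j -> edge_binomial K i j \in J.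
Proof.
have lt_in (k l : 'I_n) : (k < l)%N -> adj G k l -> edge_binomial K k l \in J.
  move=> kl a; apply: mem_ideal_gen; apply/mapP; exists (k, l) => //.
  by rewrite mem_filter /= kl a mem_enum.
move=> a; case: (ltngtP i j) => [ij|ji|/val_inj ij]; first exact: lt_in.
  rewrite edge_binomialC rpredN; apply: lt_in => //; by rewrite adj_sym.
by rewrite ij adj_irr in a.
Qed.

(** These properties hold for the edge binomials, and they only involve
    coefficients in degree at most 2, where a multiplier acts through its
    constant term. *)
Lemma edge_ideal_coef f : f \in J ->
  [/\ forall m, (mdeg m < 2)%N -> f@_m = 0,
      forall m, mdeg m = 2%N -> f@_m != 0 ->
        exists i j, m = mxy i j /\ adj G i j
    & forall i j, f@_(mxy j i) = - f@_(mxy i j)].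
Proof.
move=> fJ.
pose P (f : S) := [/\ forall m, (mdeg m < 2)%N -> f@_m = 0,
      forall m, mdeg m = 2%N -> f@_m != 0 ->
        exists i j, m = mxy i j /\ adj G i j
    & forall i j, f@_(mxy j i) = - f@_(mxy i j)].
pose I : {pred S} := fun f => `[< P f >].
suff /asboolP : f \in I by [].
move: f fJ; apply: ideal_gen_min.
- apply/asboolP; split=> [m _|m _|i j]; rewrite !mcoeff0 ?oppr0 //.
  by rewrite eqxx.
- move=> a u v /asboolP[u1 u2 u3] /asboolP[v1 v2 v3]; apply/asboolP.
  have cE m : (mdeg m <= 2)%N -> (a * u + v)@_m = a@_0%MM * u@_m + v@_m.
    by move=> m2; rewrite mcoeffD (mcoeffM_lowest a u1).
  split=> [m m1|m m2|i j].
  - by rewrite cE ?(ltnW m1) // u1 // v1 // mulr0 addr0.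
  - rewrite cE ?m2 //; case: (eqVneq u@_m 0) => [->|/(u2 m m2)//].
    by rewrite mulr0 add0r => /(v2 m m2).
  - by rewrite !cE ?mdeg_mxy // u3 v3 mulrN opprD.
move=> g /mapP[[i j]]; rewrite mem_filter /= => /andP[/andP[ij a] _] ->.
apply/asboolP; split=> [m m1|m m2|k l].
- rewrite edge_binomial_coef; case: eqP => [e|_]; first by rewrite -e mdeg_mxy in m1.
  by case: eqP => [e|_]; rewrite ?subrr //; rewrite -e mdeg_mxy in m1.
- rewrite edge_binomial_coef; case: (eqVneq (mxy i j) m) => [<- _|_].
    by exists i, j.
  case: (eqVneq (mxy j i) m) => [<- _|_]; last by rewrite subrr eqxx.
  by exists j, i; rewrite adj_sym.
- rewrite !edge_binomial_coef !eq_mxy opprB.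
  by rewrite [(j == l) && _]andbC [(i == l) && _]andbC.
Qed.

Lemma edge_binomial_homog i j : edge_binomial K i j \is 2.-homog.
Proof.
by rewrite edge_binomialE; apply: rpredB; rewrite dhomogX; apply/eqP/mdeg_mxy.
Qed.

(** The degree 2 generators already produce every edge binomial, hence the whole
    ideal, so a minimal system contains no others. *)
Lemma quadratic_generators s :
  minimal_generators J s -> {in s, forall f, f \is 2.-homog}.
Proof.
move=> [homs genJ mins].
pose t := [seq f <- s | f \is 2.-homog].
suff <- : t = s by move=> f; rewrite mem_filter => /andP[].
apply: mins; first exact: filter_subseq.
have sJ f : f \in s -> f \in J by move=> fs; rewrite -genJ; apply: mem_ideal_gen.
have ts : {subset ideal_gen t <= J}.
  move=> f; rewrite -genJ; apply: ideal_gen_subset => x.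
  by rewrite mem_filter => /andP[].
move=> f; apply/idP/idP; first exact: ts.
apply: ideal_gen_sub => {}f fE.
have : f \in J by apply: mem_ideal_gen.
have f2 : f \is 2.-homog.
  by have /mapP[p _ ->] := fE; apply: edge_binomial_homog.
rewrite -genJ => /asboolP[a fa].
(* The degree 2 part of the expression of f through the generators. *)
have -> : f = \sum_(i < size s)
    (if s`_i \is 2.-homog then ((a i)@_0%MM)%:MP * s`_i else 0).
  apply/mpolyP => m; have [m2|m2] := eqVneq (mdeg m) 2; last first.
    rewrite (dhomog_nemf_coeff f2 m2) raddf_sum big1 // => i _ /=.
    case: ifP => [hi|_]; last by rewrite mcoeff0.
    by rewrite mcoeffCM (dhomog_nemf_coeff hi m2) mulr0.
  rewrite fa !raddf_sum; apply: eq_bigr => i _ /=.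
  have [s1 _ _] := edge_ideal_coef (sJ _ (mem_nth 0 (ltn_ord i))).
  rewrite (mcoeffM_lowest _ s1) ?m2 //; case: ifP => hi; first by rewrite mcoeffCM.
  have /homogP[d hd] := homs _ (mem_nth 0 (ltn_ord i)).
  have md : mdeg m != d by rewrite m2; apply/negP => /eqP e; move: hd; rewrite -e hi.
  by rewrite (dhomog_nemf_coeff hd md) mulr0 mcoeff0.
elim/big_ind: _ => [|u v us vs|i _].
- exact: ideal_gen0.
- by rewrite -[u]mul1r; apply: ideal_gen_closed.
case: ifP => hi; last exact: ideal_gen0.
by apply/ideal_genMl/mem_ideal_gen; rewrite mem_filter hi mem_nth.
Qed.

End EdgeIdeal.

(** * From semi-paths to initial monomials and back *)

Section VertexWeightOrder.
Variables (n : nat) (rk : 'I_n -> nat).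
Implicit Types m : 'X_{1..n + n}.

(** For this weight x_i y_j exceeds x_j y_i as soon as j comes after i. *)
Definition yweight m : nat := (\sum_j m (rshift n j) * rk j)%N.

Lemma yweightD m1 m2 : yweight (m1 + m2) = (yweight m1 + yweight m2)%N.
Proof. by rewrite -big_split; apply: eq_bigr => j _; rewrite mnmDE mulnDl. Qed.

Lemma yweight_mxy i j : yweight (mxy i j) = rk j.
Proof.
rewrite /yweight (bigD1 j) //= mxy_r eqxx mul1n big1 ?addn0 // => k kj.
by rewrite mxy_r eq_sym (negPf kj).
Qed.

Definition yweight_le m1 m2 :=
  (yweight m1 < yweight m2)%N || (yweight m1 == yweight m2) && (m1 <= m2)%O.

Lemma yweight_order : monomial_order yweight_le.
Proof.
rewrite /yweight_le; split.
- by move=> m; rewrite eqxx Order.POrderTheory.lexx orbT.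
- move=> m1 m2; case: (ltngtP (yweight m1) (yweight m2)) => //= _.
  exact: Order.POrderTheory.le_anti.
- move=> m2 m1 m3 /orP[lt12|/andP[/eqP-> le12]] /orP[lt23|/andP[/eqP e23 le23]].
  + by rewrite (ltn_trans lt12 lt23).
  + by rewrite -e23 lt12.
  + by rewrite lt23.
  + by rewrite e23 eqxx (Order.POrderTheory.le_trans le12 le23) orbT.
- move=> m1 m2; case: (ltngtP (yweight m1) (yweight m2)) => //= _.
  exact: Order.TotalTheory.le_total.
split=> [m|m1 m2 m].
  have -> : yweight 0 = 0%N by apply: big1 => j _; rewrite mnm0E.
  by rewrite le0m andbT; case: (yweight m).
rewrite !yweightD ltn_add2r eqn_add2r => /orP[->//|/andP[-> le12]].
by rewrite lemc_add2l le12 orbT.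
Qed.

End VertexWeightOrder.

Section KonigFromSemiPath.
Variables (K : fieldType) (n : nat) (G H : graph 'I_n).
Variables (D : rel 'I_n) (rk : 'I_n -> nat).
Hypothesis orH : path_orientation H D rk.
Hypothesis subHG : subrel (adj H) (adj G).
Local Notation J := (binomial_edge_ideal K G).
Local Notation eb := (fun p : 'I_n * 'I_n => edge_binomial K p.1 p.2).
Implicit Types (p q : 'I_n * 'I_n).

Let pairs :=
  [seq p : 'I_n * 'I_n <- enum {: 'I_n * 'I_n} | (p.1 < p.2)%N && adj G p.1 p.2].
Let onH := [pred p : 'I_n * 'I_n | adj H p.1 p.2].
Let F := filter onH pairs.
Let F' := filter (predC onH) pairs.
Let orient p := if D p.1 p.2 then p else (p.2, p.1).

Lemma pairs_lt (p : 'I_n * 'I_n) : p \in pairs -> (p.1 < p.2)%N.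
Proof. by rewrite mem_filter => /andP[/andP[]]. Qed.

Lemma pairs_uniq : uniq pairs.
Proof. by rewrite filter_uniq ?enum_uniq. Qed.

(** The monomial x_i y_j with i < j occurs in a single edge binomial, so that no
    edge binomial can be omitted. *)
Lemma eb_coef_pairs p q : p \in pairs -> q \in pairs -> p != q ->
  (eb q)@_(mxy p.1 p.2) = 0.
Proof.
move=> /pairs_lt pl /pairs_lt ql pq; rewrite edge_binomial_coef !eq_mxy.
have -> : (q.1 == p.1) && (q.2 == p.2) = false.
  apply/negP => /andP[/eqP e1 /eqP e2]; case/eqP: pq.
  by rewrite [p]surjective_pairing [q]surjective_pairing e1 e2.
case: andP => [[/eqP e1 /eqP e2]|_]; last by rewrite subrr.
by move: pl; rewrite -e1 -e2 ltnNge (ltnW ql).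
Qed.

Lemma eb_coef_self p : p \in pairs -> (eb p)@_(mxy p.1 p.2) = 1.
Proof.
move=> /pairs_lt pl; rewrite edge_binomial_coef eqxx eq_mxy.
case: andP => [[/eqP e _]|_]; last by rewrite subr0.
by move: pl; rewrite e ltnn.
Qed.

Lemma eb_inj : {in pairs &, injective eb}.
Proof.
move=> p q pp qp e; apply/eqP; apply: contraT => pq.
have := eb_coef_self pp; rewrite e eb_coef_pairs // => /esym/eqP.
by rewrite oner_eq0.
Qed.

Lemma edge_binomials_minimal : minimal_generators J (map eb F ++ map eb F').
Proof.
rewrite -map_cat; have sE : F ++ F' =i pairs.
  by apply: perm_mem; rewrite perm_filterC.
have gen : ideal_gen (map eb (F ++ F')) =i J.
  move=> f; apply/idP/idP; apply: ideal_gen_subset => x /mapP[p pP ->];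
    by apply: map_f; rewrite ?sE // -sE.
split=> //.
  by move=> f /mapP[p _ ->]; apply: homogE (edge_binomial_homog K p.1 p.2).
move=> t ts tJ; apply/eqP; have [le <-] := size_subseq_leqif ts.
rewrite eqn_leq le /=; apply: uniq_leq_size.
  rewrite map_inj_in_uniq; last by move=> p q; rewrite !sE; apply: eb_inj.
  by rewrite (perm_uniq (permEl (perm_filterC onH pairs))) pairs_uniq.
move=> x /mapP[p]; rewrite sE => pP ->; apply: contraT => xt.
have t_low u m : u \in t -> (mdeg m < 2)%N -> u@_m = 0.
  move=> ut; have [|h _ _] := @edge_ideal_coef K n G u; last exact: h.
  by rewrite -tJ; apply: mem_ideal_gen.
pose I : {pred {mpoly K[n + n]}} := fun u =>
  `[< (forall m, (mdeg m < 2)%N -> u@_m = 0) /\ u@_(mxy p.1 p.2) = 0 >].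
suff : eb p \in I.
  by move=> /asboolP[_]; rewrite eb_coef_self // => /eqP; rewrite oner_eq0.
apply: (@ideal_gen_min _ t).
- by apply/asboolP; split=> [m _|]; rewrite mcoeff0.
- move=> a u v /asboolP[u0 um] /asboolP[v0 vm]; apply/asboolP; split=> [m m2|].
    by rewrite mcoeffD (mcoeffM_lowest a u0) ?(ltnW m2) // u0 // v0 // mulr0 addr0.
  by rewrite mcoeffD (mcoeffM_lowest a u0) ?mdeg_mxy // um vm mulr0 addr0.
- move=> u ut; apply/asboolP; split=> [m|]; first exact: t_low.
  have /mapP[q] := mem_subseq ts ut; rewrite sE => qP uE; rewrite uE.
  by apply: eb_coef_pairs => //; apply: contraNneq xt => ->; rewrite -uE.
- rewrite tJ -gen; apply: mem_ideal_gen; apply: map_f; by rewrite sE.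
Qed.

Lemma D_asym i j : D i j -> D j i = false.
Proof.
have [_ rkD _ _] := orH => /rkD ij; apply/negP => /rkD ji.
by have := ltn_trans ij ji; rewrite ltnn.
Qed.

Lemma initial_edge_binomial i j : D i j ->
  initial_monomial (yweight_le rk) (edge_binomial K i j) = 'X_[mxy i j].
Proof.
move=> ij; have [_ rkD _ _] := orH.
have nij : (i == j) = false.
  by apply/eqP => e; have := rkD _ _ ij; rewrite e ltnn.
apply: initial_monomialE; first exact: yweight_order.
  rewrite mcoeff_msupp edge_binomial_coef eqxx eq_mxy nij andbF subr0.
  exact: oner_neq0.
move=> m; rewrite mcoeff_msupp edge_binomial_coef.
case: (eqVneq (mxy i j) m) => [<- _|_].
  by have [h _ _ _ _] := yweight_order rk; apply: h.
case: (eqVneq (mxy j i) m) => [<- _|_]; last by rewrite subrr eqxx.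
by rewrite /yweight_le !yweight_mxy rkD.
Qed.

Lemma orient_D p : p \in F -> D (orient p).1 (orient p).2.
Proof.
rewrite mem_filter => /andP[/= aH _]; have [adjE _ _ _] := orH.
by rewrite /orient; case: ifP => // nD; move: aH; rewrite adjE nD.
Qed.

Lemma orient_inj : {in F &, injective orient}.
Proof.
move=> p q; rewrite !mem_filter => /andP[_ /andP[/andP[pl _] _]].
move=> /andP[_ /andP[/andP[ql _] _]].
case: p q pl ql => [i j] [k l] /= ij kl; rewrite /orient /=.
case: ifP => _; case: ifP => _ // [e1 e2]; rewrite ?e1 ?e2 //.
  by move: ij; rewrite e1 e2 ltnNge (ltnW kl).
by move: ij; rewrite e1 e2 ltnNge (ltnW kl).
Qed.

Lemma size_F : size F = #|edges H|.
Proof.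
have [adjE rkD _ _] := orH.
rewrite (card_edges_orientation orH) -(size_map orient).
have uF : uniq (map orient F).
  by rewrite (map_inj_in_uniq orient_inj) filter_uniq ?pairs_uniq.
rewrite -(card_uniqP uF); apply: eq_card => -[i j]; rewrite inE /=.
apply/mapP/idP => [[p pF e]|ij].
  by have := orient_D pF; rewrite -e.
have aij : adj H i j by rewrite adjE ij.
case: (ltngtP i j) => [lt|lt|/val_inj e].
- exists (i, j); last by rewrite /orient /= ij.
  by rewrite 2!mem_filter mem_enum /= aij lt subHG.
- exists (j, i); last by rewrite /orient /= D_asym.
  by rewrite 2!mem_filter mem_enum /= adj_sym aij lt adj_sym subHG.
- by have := rkD _ _ ij; rewrite e ltnn.
Qed.

Lemma Konig_of_orientation : ideal_height J #|edges H| -> Konig_type J.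
Proof.
have [adjE rkD Dfun Dinj] := orH.
rewrite -size_F -(size_map eb) => htJ; exists (size (map eb F)); split=> //.
exists (in_tuple (map eb F)); split.
  by exists (map eb F'); apply: edge_binomials_minimal.
exists (yweight_le rk); split; first exact: yweight_order.
pose L := [seq mxy (orient p).1 (orient p).2 | p <- F].
have -> : [seq initial_monomial (yweight_le rk) fi | fi <- map eb F]
    = [seq 'X_[m] : {mpoly K[n + n]} | m <- L].
  rewrite -!map_comp; apply/eq_in_map => p pF /=; have := orient_D pF.
  rewrite /orient; case: ifP => [Dp _|_ Dp].
    exact: initial_edge_binomial.
  rewrite edge_binomialC initial_monomialN ?initial_edge_binomial //.
  exact: yweight_order.
apply: regular_monomials.
  rewrite pairwise_map; apply: (@sub_in_pairwise _ (mem F) [rel p q | p != q]).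
  - move=> p q pF qF /= pq; have Dp := orient_D pF; have Dq := orient_D qF.
    have opq : orient p != orient q by apply: contra_neq pq; apply: orient_inj.
    apply/forallP => v; apply: contraT; rewrite negb_or => /andP[].
    case: (split_ordP v) => k ->.
      rewrite !mxy_l !eqb0 !negbK => /eqP e1 /eqP e2; case/eqP: opq.
      rewrite [LHS]surjective_pairing [RHS]surjective_pairing.
      rewrite e1 e2; congr pair; apply: (Dfun k); [rewrite -e1|rewrite -e2] => //.
    rewrite !mxy_r !eqb0 !negbK => /eqP e1 /eqP e2; case/eqP: opq.
    rewrite [LHS]surjective_pairing [RHS]surjective_pairing.
    by rewrite e1 e2; congr pair; apply: (Dinj _ _ k); [rewrite -e1|rewrite -e2].
  - exact/allP.
  - by rewrite -uniq_pairwise filter_uniq ?pairs_uniq.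
apply/mapP => -[p _ /(congr1 mdeg)]; by rewrite mdeg_mxy mdeg0.
Qed.

End KonigFromSemiPath.

Section SemiPathFromKonig.
Variables (K : fieldType) (n : nat) (G : graph 'I_n).
Local Notation J := (binomial_edge_ideal K G).

Lemma uniq_map_inj (T1 T2 : eqType) (f : T1 -> T2) s :
  uniq (map f s) -> {in s &, injective f}.
Proof.
elim: s => [|z s IH] //= /andP[fz us] x y; rewrite !inE.
case/predU1P=> [->|xs]; case/predU1P=> [->|ys] // e; last exact: IH.
  by case/negP: fz; rewrite e map_f.
by case/negP: fz; rewrite -e map_f.
Qed.

Lemma map_factor (T1 T2 T3 : eqType) (f : T1 -> T3) (g : T2 -> T3)
    (Q : T2 -> Prop) s :
  (forall x, x \in s -> exists y, f x = g y /\ Q y) ->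
  exists t, map f s = map g t /\ forall y, y \in t -> Q y.
Proof.
elim: s => [|x s IH] h; first by exists [::].
have [y [xy Qy]] := h x (mem_head _ _).
have [|t [st Qt]] := IH; first by move=> z zs; apply: h; rewrite inE zs orbT.
exists (y :: t); split=> [|z]; first by rewrite /= xy st.
by rewrite inE => /predU1P[->|/Qt].
Qed.

Lemma initial_quadratic le f : monomial_order le ->
  f \in J -> f \is 2.-homog -> f != 0 -> exists i j,
    [/\ initial_monomial le f = 'X_[mxy i j], adj G i j & le (mxy j i) (mxy i j)].
Proof.
move=> leo fJ f2 f0; have [m [mf mmax ->]] := initial_monomial_max leo f0.
have [_ hadj hsym] := edge_ideal_coef fJ.
have [i [j [mE aij]]] : exists i j, m = mxy i j /\ adj G i j.
  by apply: hadj; [apply: (dhomogP _ _ _ f2 m mf)|rewrite -mcoeff_msupp].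
exists i, j; split=> //; first by rewrite mE.
rewrite -mE; apply: mmax; rewrite mcoeff_msupp hsym oppr_eq0 -mE.
by rewrite -mcoeff_msupp.
Qed.

(** Declare i to be before j when x_j y_i is at most x_i y_j.  This is transitive:
    multiplying two such comparisons, the factor x_j y_j cancels by totality
    of the order.  The rank of j counts the vertices before it. *)
Lemma vertex_order (le : rel 'X_{1..n + n}) : monomial_order le ->
  exists rk : 'I_n -> nat, forall i j,
    i != j -> le (mxy j i) (mxy i j) -> (rk i < rk j)%N.
Proof.
move=> [le_refl le_anti le_trans le_total [_ le_add]].
pose r i j := le (mxy j i) (mxy i j).
have r_anti i j : r i j -> r j i -> i = j.
  move=> ij ji; have /mxy_inj[] // : mxy i j = mxy j i.
  by apply: le_anti; apply/andP; split.
have r_trans i j k : r i j -> r j k -> r i k.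
  move=> ij jk; have swap (a b c d : 'I_n) :
      (mxy a b + mxy c d = mxy a d + mxy c b)%MM.
    by apply/mnmP => v; rewrite !mnmDE; lia.
  have sum : le (mxy k i + mxy j j)%MM (mxy i k + mxy j j)%MM.
    rewrite (swap k i j j) (swap i k j j).
    apply: (le_trans (mxy j k + mxy j i)%MM); first exact: le_add.
    by rewrite addmC; apply: le_add.
  have /orP[//|ki] := le_total (mxy k i) (mxy i k).
  have /addIm e : (mxy k i + mxy j j = mxy i k + mxy j j)%MM.
    by apply: le_anti; rewrite sum le_add.
  by rewrite /r e.
exists (fun j => #|[pred i | (i != j) && r i j]|) => i j ij rij.
apply: proper_card; apply/properP; split.
  apply/subsetP => k; rewrite !inE => /andP[ki rki].
  rewrite (r_trans _ _ _ rki rij) andbT; apply: contraNneq ij => kj.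
  by apply/eqP/(r_anti _ _ rij); rewrite -kj.
by exists i; rewrite !inE ?ij ?eqxx.
Qed.

Lemma semi_path_of_Konig : vertices G = setT -> Konig_type J ->
  exists h H, [/\ ideal_height J h, semi_path G H & #|edges H| = h].
Proof.
move=> GT [h [htJ [f [[g minfg] [le [leo reg]]]]]].
have quad := quadratic_generators minfg.
have fJ x : x \in f -> x \in J.
  by case: minfg => _ gen _ xf; rewrite -gen; apply: mem_ideal_gen; rewrite mem_cat xf.
have f0 x : x \in f -> x != 0.
  move=> xf; apply: contraNneq (regular_sequence_neq0 reg) => x0.
  by apply/mapP; exists x; rewrite // x0 /initial_monomial eqxx.
pose Q (p : 'I_n * 'I_n) := adj G p.1 p.2 /\ le (mxy p.2 p.1) (mxy p.1 p.2).
have [|L [fL LQ]] := @map_factor _ _ _ (initial_monomial le)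
    (fun p : 'I_n * 'I_n => 'X_[mxy p.1 p.2] : {mpoly K[n + n]}) Q f.
  move=> x xf; have x2 : x \is 2.-homog by apply: quad; rewrite mem_cat xf.
  have [i [j [xij aij lij]]] := initial_quadratic leo (fJ x xf) x2 (f0 x xf).
  by exists (i, j).
have szL : size L = h.
  by rewrite -(size_tuple f) -(size_map (initial_monomial le)) fL size_map.
have gE : [seq 'X_[mxy p.1 p.2] : {mpoly K[n + n]} | p <- L]
    = [seq 'X_[m] | m <- [seq mxy p.1 p.2 | p <- L]] by rewrite -map_comp.
rewrite fL gE in reg.
have cop := regular_quadratic_monomials _ reg.
have {cop} : pairwise (fun p q : 'I_n * 'I_n => (p.1 != q.1) && (p.2 != q.2)) L.
  have /cop : {in [seq mxy p.1 p.2 | p <- L], forall m, mdeg m = 2%N}.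
    by move=> m /mapP[p _ ->]; apply: mdeg_mxy.
  rewrite pairwise_map; apply: sub_pairwise => p q /= /forallP co.
  have := co (lshift n p.1); have := co (rshift n p.2).
  by rewrite !mxy_l !mxy_r !eqxx /= !eqb0 ![q.1 == _]eq_sym ![q.2 == _]eq_sym => -> ->.
move=> disj.
have uniq1 : uniq [seq p.1 | p <- L].
  by rewrite uniq_pairwise pairwise_map; apply: sub_pairwise disj => p q /andP[].
have uniq2 : uniq [seq p.2 | p <- L].
  by rewrite uniq_pairwise pairwise_map; apply: sub_pairwise disj => p q /andP[].
have [rk rkP] := vertex_order leo.
pose D i j := (i, j) \in L.
have DG i j : D i j -> adj G i j by move=> /LQ[].
have Dneq i j : D i j -> i != j.
  by move=> /DG a; apply: contraTneq a => ->; rewrite adj_irr.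
pose a i j := D i j || D j i.
have a_sym : ssrbool.symmetric a by move=> i j; rewrite /a orbC.
have a_irr : irreflexive a.
  by move=> i; apply/negP; rewrite /a orbb => /Dneq; rewrite eqxx.
pose H := @Graph _ setT a a_sym a_irr (fun x y _ => in_setT x).
have orH : path_orientation H D rk.
  split=> //.
  - by move=> i j ij; apply: rkP (Dneq _ _ ij) _; have [] := LQ _ ij.
  - move=> i j k ij ik.
    by have [] := uniq_map_inj uniq1 ij ik (erefl i).
  - move=> i j k ik jk.
    by have [] := uniq_map_inj uniq2 ik jk (erefl k).
exists h, H; split=> //.
  split; last exact: orientation_path_graph orH.
  split; first by rewrite GT.
  by move=> i j /orP[/DG//|/DG]; rewrite adj_sym.
rewrite (card_edges_orientation orH) -szL -(card_uniqP (map_uniq uniq1)).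
by apply: eq_card => -[i j]; rewrite inE.
Qed.

End SemiPathFromKonig.

Local Close Scope ring_scope.

Theorem theorem3p5 (K : fieldType) (n : nat) (G : graph 'I_n)
    (hG : vertices G = [set: 'I_n]) (d : nat)
    (hd : krull_dim {ideal_quot (binomial_edge_ideal K G)} d) :
  (forall (P : graph 'I_n) (r : nat),
     semi_path G P -> semi_path_length P = r -> r <= 2 * n - d)
  /\ (Konig_type (binomial_edge_ideal K G)
      <-> exists P : graph 'I_n,
            semi_path G P /\ semi_path_length P = 2 * n - d).
Proof.
have N2 : (2 * n - d = n + n - d)%N by rewrite mul2n addnn.
have htJ : ideal_height (binomial_edge_ideal K G) (2 * n - d)%N.
  by rewrite N2; apply: height_krull_dim hd.
split.
  move=> H r [[_ subHG] Hpath] <-.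
  have [D [rk orH]] := path_graph_orientation Hpath.
  have [adjE rkD Dfun Dinj] := orH.
  have [P [JP dP]] := krull_dim_trdeg hd.
  have [A [iA cA]] := trdeg_indep P.
  have DP i j : D i j -> edge_binomial K i j \in P.
    by move=> ij; apply/JP/edge_binomial_in/subHG; rewrite adjE ij.
  have := card_indep_semi_path iA rkD Dfun Dinj DP.
  rewrite cA -(card_edges_orientation orH) /semi_path_length; lia.
split=> [konig|[H [[[_ subHG] Hpath] lenH]]].
  have [h [H [htJ' HG lenH]]] := semi_path_of_Konig hG konig.
  exists H; split=> //; rewrite /semi_path_length lenH.
  exact: ideal_height_unique htJ' htJ.
have [D [rk orH]] := path_graph_orientation Hpath.
by apply: (Konig_of_orientation orH subHG); rewrite -/(semi_path_length H) lenH.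
Qed.
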